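(* Let $\{\nu_t\}_{t\ge0}$ and $\{\widetilde\nu_t\}_{t\ge0}$ be weakly continuous $\rhd$-convolution semigroups in $\mathcal{P}(\mathbb{T})$ with $\nu_0=\widetilde\nu_0=\delta_1$, $\nu_1=\widetilde\nu_1$, and $\nu_1\ne\omega$. Let $B_2,\widetilde B_2:\mathbb{D}\to\mathbb{C}$ be analytic with nonpositive real parts such that, for all $t\ge0$ and $z\in\mathbb{D}$, $$\tfrac{d}{dt}\eta_{\nu_t}(z)=\eta_{\nu_t}(z)B_2(\eta_{\nu_t}(z)),\qquad \tfrac{d}{dt}\eta_{\widetilde\nu_t}(z)=\eta_{\widetilde\nu_t}(z)\widetilde B_2(\eta_{\widetilde\nu_t}(z)).$$ Let $s_1=B_2(0)$. (1) If $\nu_1$ is not a Dirac measure, there exists an integer $n$ such that $\widetilde B_2=\big(1+\frac{2\pi in}{s_1}\big)B_2$. (2) If $\nu_1$ is a Dirac measure, there exists an integer $n$ such that $\widetilde B_2=B_2+2\pi in$.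
   Context: $\mathbb{T}$ is the unit circle, $\mathbb{D}$ the open unit disc, $\mathcal{P}(\mathbb{T})$ the Borel probability measures on $\mathbb{T}$, $\omega$ the normalized Haar measure on $\mathbb{T}$, and $\delta_1$ the Dirac mass at $1$. For $\nu\in\mathcal{P}(\mathbb{T})$ let $\psi_\nu(z)=\int\frac{z\zeta}{1-z\zeta}d\nu(\zeta)$ and $\eta_\nu=\psi_\nu/(1+\psi_\nu)$ on $\mathbb{D}$; $\eta_\nu$ determines $\nu$. The multiplicative monotone convolution is defined by $\eta_{\nu\rhd\lambda}=\eta_\nu\circ\eta_\lambda$. A weakly continuous $\rhd$-convolution semigroup is a family $\{\nu_t\}_{t\ge0}$ with $\nu_{s+t}=\nu_s\rhd\nu_t$ for all $s,t\ge0$ and $t\mapsto\nu_t$ weakly continuous. *)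

(* Defs.v *)
From HB Require Import structures.
From mathcomp Require Import all_boot all_order all_algebra.
From mathcomp Require Import complex.
From mathcomp Require Import all_classical all_reals all_analysis.
Import numFieldNormedType.Exports.
Import Order.TTheory GRing.Theory Num.Theory.

Set Implicit Arguments.
Unset Strict Implicit.
Unset Printing Implicit Defensive.

Local Open Scope classical_set_scope.
Local Open Scope ring_scope.

(* Complex numbers R[i], viewed as a normed module over themselves
   (so that [derivable f z 1] is complex differentiability). *)
Definition Cx (R : realType) := (R[i])^o.

(* The plane R*R; the unit circle T is {p | p.1^2 + p.2^2 = 1}, and a
   point p is identified with the complex number p.1 + i p.2. *)
Definition cplx (R : realType) (p : R * R) : Cx R := Complex p.1 p.2.

Definition unit_circle (R : realType) : set (R * R) :=
  [set p | p.1 ^+ 2 + p.2 ^+ 2 = 1].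

Definition disc (R : realType) : set (Cx R) := [set z | `|z| < 1].

Definition on_circle (R : realType) (P : probability (R * R)%type R) : Prop :=
  P (@unit_circle R) = 1%E.

Definition cintegral (R : realType) (P : probability (R * R)%type R)
  (f : R * R -> Cx R) : Cx R :=
  Complex (Rintegral P setT (fun p => complex.Re (f p)))
          (Rintegral P setT (fun p => complex.Im (f p))).

Definition psiT (R : realType) (P : probability (R * R)%type R) (z : Cx R) : Cx R :=
  cintegral P (fun p => z * cplx p / (1 - z * cplx p)).

Definition etaT (R : realType) (P : probability (R * R)%type R) (z : Cx R) : Cx R :=
  psiT P z / (1 + psiT P z).

Definition meq (R : realType) (P Q : set (R * R) -> \bar R) : Prop :=
  forall A, measurable A -> P A = Q A.

Definition is_dirac (R : realType) (P : set (R * R) -> \bar R) : Prop :=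
  exists p : R * R, meq P (\d_p).

Definition haarT (R : realType) (A : set (R * R)) : \bar R :=
  (lebesgue_measure [set th : R | (0 <= th < 2 * pi)%R /\ A (cos th, sin th)]
   * ((2 * pi)^-1)%:E)%E.

Definition weakly_continuous (R : realType) (nu : R -> probability (R * R)%type R) : Prop :=
  forall f : R * R -> R, continuous f -> (exists M : R, forall p, `|f p| <= M) ->
    {within [set t : R | 0 <= t], continuous (fun t => Rintegral (nu t) setT f)}.

(* derivative of a real function at t >= 0, relative to [0, +oo)
   (one-sided at t = 0, ordinary two-sided for t > 0) *)
Definition has_deriv_nonneg (R : realType) (f : R -> R) (t l : R) : Prop :=
  (fun h : R => h^-1 * (f (t + h) - f t))
    @ within (fun h : R => h != 0 /\ 0 <= t + h) (nbhs (0 : R)) --> l.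

Definition has_derivC_nonneg (R : realType) (f : R -> Cx R) (t : R) (l : Cx R) : Prop :=
  has_deriv_nonneg (fun s => complex.Re (f s)) t (complex.Re l) /\
  has_deriv_nonneg (fun s => complex.Im (f s)) t (complex.Im l).

(* {nu_t}_{t >= 0} is a weakly continuous |>-convolution semigroup in P(T),
   where nu |> lambda is defined by eta_{nu |> lambda} = eta_nu o eta_lambda *)
Definition monotone_semigroup (R : realType) (nu : R -> probability (R * R)%type R) : Prop :=
  (forall t, 0 <= t -> on_circle (nu t)) /\
  (forall s t, 0 <= s -> 0 <= t ->
     forall z, @disc R z -> etaT (nu (s + t)) z = etaT (nu s) (etaT (nu t) z)) /\
  weakly_continuous nu.

Definition two_pi_i (R : realType) (n : int) : Cx R := Complex 0 (2 * pi * n%:~R).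

(* Main.v *)
Require Import Defs.
From HB Require Import structures.
From mathcomp Require Import all_boot all_order all_algebra.
From mathcomp Require Import complex.
From mathcomp Require Import all_classical all_reals all_analysis.
From mathcomp Require Import measurable_realfun ring lra.
Import numFieldNormedType.Exports.
Import Order.TTheory GRing.Theory Num.Theory.
Local Open Scope classical_set_scope.
Local Open Scope ring_scope.

Set Implicit Arguments.
Unset Strict Implicit.
Unset Printing Implicit Defensive.

(** The flow [eta_t] of the holomorphic vector field [z B(z)] fixes 0 with multiplier
    [eta_1'(0) = exp (B 0)], so [B~ 0 - B 0] is a multiple of [2 pi i].

    If [nu_1] is a Dirac mass then [|eta_t(z)| = |z|] for [t <= 1] by the Schwarz lemma,
    hence [Re B = 0] and [B] is constant.

    Otherwise the Schwarz lemma for [eta_1] is strict, uniformly on compact subsets of the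
    disc, so [eta_n(z)] tends to 0.  Differentiating [eta_(n + h) = eta_n o eta_h] at
    [h = 0] gives [eta_n'(z) z B(z) = eta_n(z) B(eta_n(z))], and the same identity for
    [B~] since [eta~_n = eta_n] for integers [n].  Eliminating [eta_n'(z)] yields
    [B(eta_n(z)) B~(z) = B~(eta_n(z)) B(z)], and [n -> oo] gives
    [B(0) B~(z) = B~(0) B(z)]. *)

(** The two semigroups are known to agree only at integer times, so their generators cannot be
    compared by differentiating in [t]. Both vector fields are, however, invariant under the same
    map [eta_1], whose orbits approach the fixed point 0, and such a field is determined up to a
    factor fixed at 0. The Koenigs linearisation of [eta_1] would express this too; eliminating
    [eta_n'(z)] avoids constructing it.

    Three quantitative facts make the elimination legitimate. The defect in the Schwarz inequality
    is proportional to the variance of [nu_1], which is positive unless [nu_1] is a Dirac mass.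
    Cancelling the factor [eta_n(z)] requires that an orbit never reaches 0 in finite time, which is
    a Gronwall estimate. Dividing by [B 0] requires [B 0 <> 0]: otherwise [eta_1] would have
    multiplier 1 at 0, against the strict Schwarz inequality. *)

Section Modulus.
Context {R : realType}.
Implicit Types z w : Cx R.

(** The norm of [Cx R] takes its values in [R[i]]; this one takes them in [R], where the order is
    total and real arithmetic applies. *)
Definition cmod z : R := Normc.normc z.

Lemma normE_cmod z : `|z| = (cmod z)%:C%C :> R[i].
Proof. by []. Qed.

Lemma discE z : disc z = (cmod z < 1) :> Prop.
Proof. by rewrite /disc /= -[X in (X < _)]/((cmod z)%:C%C) -(ltcR (cmod z) 1). Qed.

Lemma sqr_cmod z : cmod z ^+ 2 = complex.Re z ^+ 2 + complex.Im z ^+ 2.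
Proof. by case: z => a b; rewrite /cmod /= sqr_sqrtr// addr_ge0 ?sqr_ge0. Qed.

Lemma cmod_ge0 z : 0 <= cmod z.
Proof. by case: z => a b; rewrite /cmod /= sqrtr_ge0. Qed.

Lemma cmodM z w : cmod (z * w) = cmod z * cmod w.
Proof. exact: Normc.normcM. Qed.

Lemma cmodV z : cmod z^-1 = (cmod z)^-1.
Proof. exact: Normc.normcV. Qed.

Lemma cmod0 : cmod 0 = 0.
Proof. exact: Normc.normc0. Qed.

Lemma cmod1 : cmod 1 = 1.
Proof. exact: Normc.normc1. Qed.

Lemma cmodD z w : cmod (z + w) <= cmod z + cmod w.
Proof. exact: le_normcD. Qed.

Lemma cmodN z : cmod (- z) = cmod z.
Proof. exact: normcN. Qed.

Lemma cmodB z w : cmod (z - w) = cmod (w - z).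
Proof. by rewrite -cmodN opprB. Qed.

Lemma cmod_le_dist z w : cmod z <= cmod w + cmod (z - w).
Proof. by rewrite -{1}(subrK w z) addrC; apply: cmodD. Qed.

Lemma cmod_eq0 z : cmod z = 0 -> z = 0.
Proof. exact: Normc.eq0_normc. Qed.

Lemma cmod_gt0 z : z != 0 -> 0 < cmod z.
Proof.
by move=> z0; rewrite lt_def cmod_ge0 andbT; apply: contra z0 => /eqP/cmod_eq0 ->.
Qed.

Lemma normr_Re_le z : `|complex.Re z| <= cmod z.
Proof.
rewrite -(ler_pXn2r (n:=2))// ?nnegrE ?cmod_ge0// sqr_cmod real_normK ?num_real//.
by rewrite lerDl sqr_ge0.
Qed.

Lemma normr_Im_le z : `|complex.Im z| <= cmod z.
Proof.
rewrite -(ler_pXn2r (n:=2))// ?nnegrE ?cmod_ge0// sqr_cmod real_normK ?num_real//.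
by rewrite lerDr sqr_ge0.
Qed.

Lemma cmod_le_ReIm z : cmod z <= `|complex.Re z| + `|complex.Im z|.
Proof.
rewrite -(ler_pXn2r (n:=2))// ?nnegrE ?cmod_ge0 ?addr_ge0// sqr_cmod.
rewrite sqrrD !real_normK ?num_real// lerD2r lerDl mulrn_wge0// mulr_ge0//.
Qed.

Lemma cmod_real (x : R) : cmod (x%:C%C : Cx R) = `|x|.
Proof. by rewrite /cmod /= expr0n addr0 sqrtr_sqr. Qed.

Lemma eqC_small z w : (forall e : R, 0 < e -> cmod (z - w) <= e) -> z = w.
Proof.
move=> h; apply/eqP; rewrite -subr_eq0; apply/negPn/negP => /cmod_gt0 d0.
have := h (cmod (z - w) / 2); rewrite divr_gt0// => /(_ isT).
by rewrite leNgt ltr_pdivrMr// mulr_natr mulr2n ltrDl d0.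
Qed.

End Modulus.

(** * Integrals of bounded functions against measures carried by the circle *)

Section CircleIntegral.
Context {R : realType}.
Implicit Types (f g : R * R -> R) (F G : R * R -> Cx R) (c : Cx R).

Lemma measurable_unit_circle : measurable (@unit_circle R).
Proof.
have m : measurable_fun setT (fun p : R * R => p.1 ^+ 2 + p.2 ^+ 2).
  apply: measurable_funD; apply: measurable_funX.
    exact: measurable_fst.
  exact: measurable_snd.
by have := m measurableT _ (measurable_set1 (1 : R)); rewrite setTI.
Qed.

Lemma cmod_cplx (p : R * R) : unit_circle p -> cmod (cplx p) = 1.
Proof. by rewrite /unit_circle /cmod /= => ->; rewrite sqrtr1. Qed.

(** Measures live on the plane, but [1 / (1 - z zeta)] is unbounded there when [z <> 0], with a pole
    at [1 / z]. Boundedness is therefore asked on the circle alone, which has full mass, while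
    measurability is global. *)
Definition circle_bounded f := measurable_fun setT f /\
  exists M : R, forall p, unit_circle p -> `|f p| <= M.

Definition circle_boundedC F := circle_bounded (fun p => complex.Re (F p)) /\
  circle_bounded (fun p => complex.Im (F p)).

Lemma circle_bounded_cst (a : R) : circle_bounded (fun=> a).
Proof. by split; [exact: measurable_cst | exists `|a|]. Qed.

Lemma circle_boundedD f g : circle_bounded f -> circle_bounded g ->
  circle_bounded (fun p => f p + g p).
Proof.
move=> [mf [M fM]] [mg [N gN]]; split; first exact: measurable_funD.
exists (M + N) => p cp; apply: le_trans (ler_normD _ _) _.
by rewrite lerD ?fM ?gN.
Qed.

Lemma circle_boundedM f g : circle_bounded f -> circle_bounded g ->
  circle_bounded (fun p => f p * g p).
Proof.
move=> [mf [M fM]] [mg [N gN]]; split; first exact: measurable_funM.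
by exists (M * N) => p cp; rewrite normrM ler_pM// ?fM ?gN.
Qed.

Lemma circle_boundedN f : circle_bounded f -> circle_bounded (fun p => - f p).
Proof.
move=> bf; have := circle_boundedM (circle_bounded_cst (-1)) bf.
by congr circle_bounded; apply/funext => p; rewrite mulN1r.
Qed.

Lemma circle_boundedV f (c : R) : circle_bounded f -> (forall p, 0 <= f p) -> 0 < c ->
  (forall p, unit_circle p -> c <= f p) -> circle_bounded (fun p => (f p)^-1).
Proof.
move=> [mf _] f0 c0 cf; split.
  (* Measurability comes from the real power of exponent -1, which agrees with inversion on
     nonnegative reals. Hence [0 <= f] on the whole plane, but [c <= f] only on the circle. *)
  under eq_fun do rewrite -powR_inv1//.
  exact: (measurableT_comp (measurable_powR (-1))).
exists c^-1 => p cp; rewrite ger0_norm ?invr_ge0// lef_pV2 ?posrE ?cf//.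
by rewrite (lt_le_trans c0) ?cf.
Qed.

Lemma circle_boundedC_cst c : circle_boundedC (fun=> c).
Proof. by split; exact: circle_bounded_cst. Qed.

Lemma circle_boundedCD F G : circle_boundedC F -> circle_boundedC G ->
  circle_boundedC (fun p => F p + G p).
Proof.
move=> [rF iF] [rG iG]; split.
  have := circle_boundedD rF rG; congr circle_bounded; apply/funext => p.
  by case: (F p) (G p) => [a b] [].
have := circle_boundedD iF iG; congr circle_bounded; apply/funext => p.
by case: (F p) (G p) => [a b] [].
Qed.

Lemma circle_boundedCM F G : circle_boundedC F -> circle_boundedC G ->
  circle_boundedC (fun p => F p * G p).
Proof.
move=> [rF iF] [rG iG]; split.
  have := circle_boundedD (circle_boundedM rF rG)
    (circle_boundedN (circle_boundedM iF iG)).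
  by congr circle_bounded; apply/funext => p; case: (F p) (G p) => [a b] [].
have := circle_boundedD (circle_boundedM rF iG) (circle_boundedM iF rG).
by congr circle_bounded; apply/funext => p; case: (F p) (G p) => [a b] [].
Qed.

Lemma circle_boundedCN F : circle_boundedC F -> circle_boundedC (fun p => - F p).
Proof.
move=> bF; have := circle_boundedCM (circle_boundedC_cst (-1)) bF.
by congr circle_boundedC; apply/funext => p; rewrite mulN1r.
Qed.

Lemma circle_boundedCV F (c : R) : circle_boundedC F -> 0 < c ->
  (forall p, unit_circle p -> c <= cmod (F p)) ->
  circle_boundedC (fun p => (F p)^-1).
Proof.
move=> [rF iF] c0 cF.
(* [1 / F] is the conjugate of [F] over [|F|^2], so only a nonnegative real function has to be
   inverted. *)
have b2 : circle_bounded (fun p => (cmod (F p) ^+ 2)^-1).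
  apply: (@circle_boundedV _ (c ^+ 2)).
  - under eq_fun do rewrite sqr_cmod !expr2.
    by apply: circle_boundedD; apply: circle_boundedM.
  - by move=> p; apply: sqr_ge0.
  - by rewrite exprn_gt0.
  - by move=> p /cF cp; rewrite ler_pXn2r// nnegrE ?cmod_ge0// ltW.
split.
  have := circle_boundedM rF b2.
  congr circle_bounded; apply/funext => p; rewrite sqr_cmod; by case: (F p).
have := circle_boundedN (circle_boundedM iF b2).
congr circle_bounded; apply/funext => p; rewrite sqr_cmod; by case: (F p).
Qed.

Lemma circle_boundedC_cplx : circle_boundedC (@cplx R).
Proof.
have le1 (x y : R) : x ^+ 2 + y ^+ 2 = 1 -> `|x| <= 1.
  move=> h; rewrite -(ler_pXn2r (n:=2))// ?nnegrE// expr1n real_normK ?num_real//.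
  by rewrite -h lerDl sqr_ge0.
split; split.
- exact: measurable_fst.
- by exists 1 => p; exact: le1.
- exact: measurable_snd.
- by exists 1 => p; rewrite /unit_circle /= addrC; exact: le1.
Qed.

Lemma dist1_circle_ge (z : Cx R) p : unit_circle p -> 1 - cmod z <= cmod (1 - z * cplx p).
Proof.
move=> cp; rewrite lerBlDr; have := @cmodD R (1 - z * cplx p) (z * cplx p).
by rewrite subrK cmod1 cmodM (cmod_cplx cp) mulr1.
Qed.

Lemma dist1_circle_neq0 (z : Cx R) p : cmod z < 1 -> unit_circle p -> 1 - z * cplx p != 0.
Proof.
move=> z1 cp; apply/eqP => h; have := dist1_circle_ge z cp.
by rewrite h cmod0 leNgt subr_gt0 z1.
Qed.

Definition kern (z : Cx R) (p : R * R) : Cx R := (1 - z * cplx p)^-1.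

Lemma circle_boundedC_kern z : cmod z < 1 -> circle_boundedC (kern z).
Proof.
move=> z1; apply: (@circle_boundedCV _ (1 - cmod z)).
- apply: circle_boundedCD; first exact: circle_boundedC_cst.
  apply: circle_boundedCN; apply: circle_boundedCM; first exact: circle_boundedC_cst.
  exact: circle_boundedC_cplx.
- by rewrite subr_gt0.
- by move=> p; exact: dist1_circle_ge.
Qed.

Section Measure.
Variable P : probability (R * R)%type R.
Hypothesis PT : on_circle P.

Let PTC : P (~` (@unit_circle R)) = 0%E.
Proof.
by rewrite probability_setC ?PT ?subee//; exact: measurable_unit_circle.
Qed.

Lemma circle_integrable f : circle_bounded f -> P.-integrable setT (EFin \o f).
Proof.
move=> [mf [M fM]].
have mT := measurable_unit_circle.
apply/(@negligible_integrable _ _ _ P setT (~` (@unit_circle R))) => //.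
- exact: measurableC.
- exact/measurable_EFinP.
rewrite setDE setCK setTI; apply: measurable_bounded_integrable => //.
- exact: (eq_ind_r (fun x => x < +oo)%E (ltry 1) PT).
- exact: measurable_funS mf.
- exists M; split; first by rewrite num_real.
  by move=> x Mx p cp; apply: le_trans (fM _ cp) (ltW Mx).
Qed.

Lemma circle_RintegralE f : circle_bounded f ->
  Rintegral P setT f = Rintegral P (@unit_circle R) f.
Proof.
move=> bf; rewrite /Rintegral.
rewrite (@negligible_integral _ _ _ P setT (~` (@unit_circle R)))//.
- by rewrite setDE setCK setTI.
- by apply: measurableC; exact: measurable_unit_circle.
- exact: circle_integrable.
Qed.

Lemma circle_Rintegral_eq f g : circle_bounded f -> circle_bounded g ->
  (forall p, unit_circle p -> f p = g p) ->
  Rintegral P setT f = Rintegral P setT g.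
Proof.
move=> bf bg fg; rewrite !circle_RintegralE//; apply: eq_Rintegral => p.
by rewrite inE => /fg.
Qed.

Lemma circle_Rintegral_le f g : circle_bounded f -> circle_bounded g ->
  (forall p, unit_circle p -> f p <= g p) ->
  Rintegral P setT f <= Rintegral P setT g.
Proof.
move=> bf bg fg; rewrite !circle_RintegralE//.
have mT := measurable_unit_circle.
by apply: le_Rintegral => //; apply: (@integrableS _ _ _ _ setT) => //;
  apply: circle_integrable.
Qed.

Lemma prob_Rintegral_cst (a : R) : Rintegral P setT (fun=> a) = a.
Proof.
have P1 : fine (P setT) = 1 by rewrite probability_setT.
by rewrite Rintegral_cst// -[RHS]mulr1; congr (_ * _).
Qed.

Lemma circle_Rintegral_norm_le f (M : R) : circle_bounded f ->
  (forall p, unit_circle p -> `|f p| <= M) -> `|Rintegral P setT f| <= M.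
Proof.
move=> bf fM; rewrite ler_norml -[leLHS]prob_Rintegral_cst -[X in _ && (_ <= X)]prob_Rintegral_cst.
by apply/andP; split; apply: circle_Rintegral_le => //; try exact: circle_bounded_cst;
  move=> p /fM; rewrite ler_norml => /andP[].
Qed.

Lemma circle_RintegralD f g : circle_bounded f -> circle_bounded g ->
  Rintegral P setT (fun p => f p + g p) = Rintegral P setT f + Rintegral P setT g.
Proof. by move=> bf bg; rewrite RintegralD//; exact: circle_integrable. Qed.

Lemma circle_RintegralZ (a : R) f : circle_bounded f ->
  Rintegral P setT (fun p => a * f p) = a * Rintegral P setT f.
Proof. by move=> bf; rewrite RintegralZl//; exact: circle_integrable. Qed.

Lemma circle_RintegralN f : circle_bounded f ->
  Rintegral P setT (fun p => - f p) = - Rintegral P setT f.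
Proof.
move=> bf; rewrite -mulN1r -circle_RintegralZ//; congr Rintegral.
by apply/funext => p; rewrite mulN1r.
Qed.

Lemma cintegralD F G : circle_boundedC F -> circle_boundedC G ->
  cintegral P (fun p => F p + G p) = cintegral P F + cintegral P G.
Proof.
move=> [rF iF] [rG iG]; apply: etrans (_ : Complex (_ + _) (_ + _) = _); last by [].
rewrite -!circle_RintegralD//; congr Complex; congr Rintegral; apply/funext => p;
 by case: (F p) (G p) => [a b] [].
Qed.

Lemma cintegralZ c F : circle_boundedC F ->
  cintegral P (fun p => c * F p) = c * cintegral P F.
Proof.
case: c => x y [rF iF].
apply: etrans (_ : Complex (x * _ - y * _) (x * _ + y * _) = _); last by [].
have bZ (a : R) f : circle_bounded f -> circle_bounded (fun p => a * f p).
  by apply: circle_boundedM; exact: circle_bounded_cst.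
rewrite -!circle_RintegralZ// -circle_RintegralN; last exact: bZ.
rewrite -!circle_RintegralD; do ?[exact: bZ|apply: circle_boundedN]; last first.
congr Complex; congr Rintegral; apply/funext => p;
 by case: (F p) => a b.
Qed.

Lemma cintegral_cst c : cintegral P (fun=> c) = c.
Proof. by rewrite /cintegral !prob_Rintegral_cst; case: c. Qed.

Lemma cintegral_eq F G : circle_boundedC F -> circle_boundedC G ->
  (forall p, unit_circle p -> F p = G p) -> cintegral P F = cintegral P G.
Proof.
move=> [rF iF] [rG iG] FG; congr Complex; apply: circle_Rintegral_eq => // p /FG -> //.
Qed.

(** The factor 2 is the price of bounding the real and imaginary parts separately; it only affects
    constants downstream. *)
Lemma cintegral_norm_le F (M : R) : circle_boundedC F ->
  (forall p, unit_circle p -> cmod (F p) <= M) -> cmod (cintegral P F) <= 2 * M.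
Proof.
move=> [rF iF] FM; apply: le_trans (cmod_le_ReIm _) _; rewrite mulr_natl mulr2n lerD//=;
  apply: circle_Rintegral_norm_le => // p /FM; apply: le_trans.
  exact: normr_Re_le.
exact: normr_Im_le.
Qed.

End Measure.
End CircleIntegral.

(** * Variance of a probability measure on the circle *)

Section EtaTransform.
Context {R : realType}.
Implicit Types (f g u v x y : R * R -> R) (z w : Cx R).

Lemma measurable_plane_set1 (m : R * R) : measurable [set m].
Proof.
have := measurableX (measurable_set1 m.1) (measurable_set1 m.2).
by congr (measurable _); case: m => a b; apply/seteqP; split => -[c d] //=;
  [case=> -> ->|move=> []].
Qed.

Lemma is_dirac_of_full (P : probability (R * R)%type R) (m : R * R) :
  P [set m] = 1%E -> is_dirac P.
Proof.
move=> Pm; exists m => A mA.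
have mm := measurable_plane_set1 m.
rewrite diracE; case: (boolP (m \in A)) => [|] mA'.
  apply/eqP; rewrite eq_le probability_le1//=.
  rewrite -Pm; apply: le_measure; rewrite ?inE//.
  by move=> p /= ->; move: mA'; rewrite inE.
apply/eqP; rewrite eq_le measure_ge0 andbT.
have PC : P (~` [set m]) = 0%E by rewrite probability_setC// Pm subee.
apply: (@le_trans _ _ (P (~` [set m]))); last by rewrite PC.
apply: le_measure; rewrite ?inE//; first exact: measurableC.
by move=> p Ap /= pm; move: mA'; rewrite notin_setE -pm.
Qed.

Section OnCircle.
Variable P : probability (R * R)%type R.
Hypothesis PT : on_circle P.

Lemma circle_affine_integral u v (a b c : R) : circle_bounded u -> circle_bounded v ->
  Rintegral P setT (fun p => a * u p + (b * v p + c)) =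
  a * Rintegral P setT u + (b * Rintegral P setT v + c).
Proof.
move=> bu bv; have bZ (k : R) f : circle_bounded f -> circle_bounded (fun p => k * f p).
  by apply: circle_boundedM; exact: circle_bounded_cst.
rewrite circle_RintegralD//; [|exact: bZ|]; last first.
  by apply: circle_boundedD; [exact: bZ|exact: circle_bounded_cst].
rewrite circle_RintegralD//; [|exact: bZ|exact: circle_bounded_cst].
by rewrite !circle_RintegralZ// prob_Rintegral_cst.
Qed.

Lemma circle_affine_bounded u v (a b c : R) : circle_bounded u -> circle_bounded v ->
  circle_bounded (fun p => a * u p + (b * v p + c)).
Proof.
move=> bu bv; apply: circle_boundedD.
  by apply: circle_boundedM => //; exact: circle_bounded_cst.
apply: circle_boundedD; last exact: circle_bounded_cst.
by apply: circle_boundedM => //; exact: circle_bounded_cst.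
Qed.

(** The shape in which quadratic inequalities get averaged: squares of [zeta] and of the kernel
    reduce, by the equations of the circles they run over, to affine functions of two real
    coordinates. *)
Lemma circle_affine_le u v x y (a b c a' b' c' : R) :
  circle_bounded u -> circle_bounded v -> circle_bounded x -> circle_bounded y ->
  (forall p, unit_circle p ->
    a * u p + (b * v p + c) <= a' * x p + (b' * y p + c')) ->
  a * Rintegral P setT u + (b * Rintegral P setT v + c) <=
  a' * Rintegral P setT x + (b' * Rintegral P setT y + c').
Proof.
move=> bu bv bx by_ h; rewrite -!circle_affine_integral//.
by apply: circle_Rintegral_le => //; exact: circle_affine_bounded.
Qed.

Definition moment1 : Cx R := cintegral P (@cplx R).

(** This is the variance [E|zeta - m|^2] with [m] the mean, because [|zeta| = 1] almost surely. *)
Definition circle_var : R := 1 - cmod moment1 ^+ 2.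

Let bx : circle_bounded (fun p : R * R => p.1).
Proof. exact: circle_boundedC_cplx.1. Qed.
Let by_ : circle_bounded (fun p : R * R => p.2).
Proof. exact: circle_boundedC_cplx.2. Qed.

Let m1 : R := complex.Re moment1.
Let m2 : R := complex.Im moment1.
Let dev (p : R * R) : R := (p.1 - m1) ^+ 2 + (p.2 - m2) ^+ 2.

Let dev_bounded : circle_bounded dev.
Proof.
have bB (k : R) f : circle_bounded f -> circle_bounded (fun p => (f p - k) ^+ 2).
  by move=> bf; under eq_fun do rewrite expr2; apply: circle_boundedM;
    apply: circle_boundedD => //; exact: circle_bounded_cst.
by apply: circle_boundedD; exact: bB.
Qed.

Let integral_dev : Rintegral P setT dev = circle_var.
Proof.
rewrite (_ : Rintegral P setT dev = Rintegral P setT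
   (fun p => (- 2 * m1) * p.1 + ((- 2 * m2) * p.2 + (1 + m1 ^+ 2 + m2 ^+ 2)))); last first.
  apply: circle_Rintegral_eq => //; first exact: circle_affine_bounded.
  by move=> p; rewrite /unit_circle /= /dev => p1; lra.
rewrite circle_affine_integral// /circle_var sqr_cmod -/m1 -/m2.
rewrite -[Rintegral P setT (fun p => p.1)]/m1 -[Rintegral P setT (fun p => p.2)]/m2.
by ring.
Qed.

Lemma circle_var_ge0 : 0 <= circle_var.
Proof.
by rewrite -integral_dev; apply: Rintegral_ge0 => p _; rewrite addr_ge0 ?sqr_ge0.
Qed.

(** With zero variance the nonnegative function [dev] vanishes almost everywhere; its only zero is
    the mean, which then carries all the mass. *)
Lemma circle_var_gt0 : ~ is_dirac P -> 0 < circle_var.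
Proof.
move=> ndP; rewrite lt_def circle_var_ge0 andbT; apply/eqP => V0; apply: ndP.
have dev0 p : 0 <= dev p by rewrite addr_ge0 ?sqr_ge0.
have int0 : (\int[P]_p `|(dev p)%:E| = 0)%E.
  under eq_integral do rewrite abse_EFin ger0_norm//.
  have fin : (\int[P]_p (dev p)%:E \is a fin_num)%E.
    by apply: integrable_fin_num => //; exact: circle_integrable.
  by rewrite -(fineK fin); congr EFin; rewrite -[LHS]integral_dev in V0 *.
have mdev : measurable_fun setT (EFin \o dev).
  by apply/measurable_EFinP; case: dev_bounded.
have [N [mN PN0 devN]] := (ae_eq_integral_abs P measurableT mdev).1 int0.
apply: (@is_dirac_of_full _ (m1, m2)).
have devm p : dev p = 0 -> p = (m1, m2).
  case: p => a b /eqP; rewrite /dev paddr_eq0 ?sqr_ge0// !sqrf_eq0 !subr_eq0 /=.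
  by case/andP => /eqP -> /eqP ->.
have mm := measurable_plane_set1 (m1, m2).
have PC : P (~` [set (m1, m2)]) = 0%E.
  apply/eqP; rewrite -measure_le0 -PN0; apply: le_measure; rewrite ?inE//.
    exact: measurableC.
  move=> p /= pm; apply: devN => /= /(_ I) [] /devm.
  exact: pm.
by rewrite -[X in P X]setCK probability_setC ?PC ?sube0//; exact: measurableC.
Qed.

End OnCircle.
End EtaTransform.

(** * Cauchy transform, quantitative Schwarz lemma and differentiability of eta *)

Section EtaEstimates.
Context {R : realType}.
Implicit Types (z w : Cx R).

(* [1 / (1 - u)], [|u| = r], runs over the circle of centre [1 / (1 - r^2)] and
   radius [r / (1 - r^2)]; this is its equation. *)
Lemma kern_identity z p : cmod z < 1 -> unit_circle p ->
  (1 - cmod z ^+ 2) * cmod (kern z p) ^+ 2 = 2 * complex.Re (kern z p) - 1.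
Proof.
move=> z1 cp; have := dist1_circle_neq0 z1 cp.
have -> : cmod z = cmod (z * cplx p) by rewrite cmodM cmod_cplx// mulr1.
rewrite /kern; move: (z * cplx p) => {z z1} [a b] /cmod_gt0 n0.
have d0 : (1 - a) ^+ 2 + b ^+ 2 != 0.
  by have := exprn_gt0 2 n0; rewrite sqr_cmod /= => /lt0r_neq0; rewrite sub0r sqrrN.
rewrite cmodV exprVn !sqr_cmod /= sub0r sqrrN.
by field.
Qed.

(** The map [u -> 1 / (1 - u)] sends the disc into this half plane, which is convex and so also
    contains the mean of the kernel. *)
Lemma Re_kern_ge z p : cmod z < 1 -> unit_circle p -> 1 / 2 <= complex.Re (kern z p).
Proof.
move=> z1 cp; have := kern_identity z1 cp => h.
suff : 0 <= (1 - cmod z ^+ 2) * cmod (kern z p) ^+ 2 by rewrite h; lra.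
by rewrite mulr_ge0 ?sqr_ge0// subr_ge0 expr_le1 ?cmod_ge0// ltW.
Qed.

Lemma cmod_kern_le z p : cmod z < 1 -> unit_circle p -> cmod (kern z p) <= (1 - cmod z)^-1.
Proof.
move=> z1 cp; rewrite /kern cmodV lef_pV2 ?dist1_circle_ge// posrE ?subr_gt0//.
exact/cmod_gt0/dist1_circle_neq0.
Qed.

Lemma cmod_kern_ge z p : cmod z < 1 -> unit_circle p -> 1 / 2 <= cmod (kern z p).
Proof.
move=> z1 cp; apply: le_trans (Re_kern_ge z1 cp) _.
by apply: le_trans (normr_Re_le _); rewrite ler_norm.
Qed.

Section OnCircle.
Variable P : probability (R * R)%type R.
Hypothesis PT : on_circle P.

(** Equal to [1 + psi] on the disc, which turns eta into [1 - 1 / A] with [A] in the half plane of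
    real part at least 1/2, away from 0. *)
Definition cauchyT z : Cx R := cintegral P (kern z).

Lemma psiTE z : cmod z < 1 -> psiT P z = cauchyT z - 1.
Proof.
move=> z1; rewrite /psiT -[X in _ - X](cintegral_cst P 1) -[X in _ + X]mulN1r.
have bk := circle_boundedC_kern z1; have b1 := @circle_boundedC_cst R 1.
rewrite -cintegralZ// -cintegralD//; last first.
  by apply: circle_boundedCM => //; exact: circle_boundedC_cst.
apply: cintegral_eq => //.
- apply: circle_boundedCM => //; apply: circle_boundedCM; last exact: circle_boundedC_cplx.
  exact: circle_boundedC_cst.
- by apply: circle_boundedCD => //; apply: circle_boundedCM => //; exact: circle_boundedC_cst.
- by move=> p cp; rewrite /kern; have := dist1_circle_neq0 z1 cp => h; field.
Qed.

Lemma Re_cauchyT_ge z : cmod z < 1 -> 1 / 2 <= complex.Re (cauchyT z).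
Proof.
move=> z1; rewrite /= -(prob_Rintegral_cst P (1 / 2)).
apply: circle_Rintegral_le => //; first exact: circle_bounded_cst.
  exact: (circle_boundedC_kern z1).1.
by move=> p; exact: Re_kern_ge.
Qed.

Lemma cmod_cauchyT_ge z : cmod z < 1 -> 1 / 2 <= cmod (cauchyT z).
Proof.
move=> z1; apply: le_trans (Re_cauchyT_ge z1) _.
by apply: le_trans (normr_Re_le _); rewrite ler_norm.
Qed.

Lemma cauchyT_neq0 z : cmod z < 1 -> cauchyT z != 0.
Proof.
move=> z1; apply/eqP => h; have := cmod_cauchyT_ge z1; rewrite h cmod0; lra.
Qed.

Lemma cmod_cauchyTV_le z : cmod z < 1 -> cmod (cauchyT z)^-1 <= 2.
Proof.
move=> z1; have := cmod_cauchyT_ge z1; rewrite cmodV => h.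
have : 0 < (1 / 2 : R) by lra.
by move=> h2; rewrite -(invrK 2) lef_pV2 ?posrE; [lra|lra|lra].
Qed.

Lemma cmod_cauchyT_le z : cmod z < 1 -> cmod (cauchyT z) <= 2 * (1 - cmod z)^-1.
Proof.
move=> z1; apply: cintegral_norm_le => //; first exact: circle_boundedC_kern.
by move=> p; exact: cmod_kern_le.
Qed.

Lemma etaTE z : cmod z < 1 -> etaT P z = 1 - (cauchyT z)^-1.
Proof.
move=> z1; rewrite /etaT psiTE// [1 + _]addrC subrK mulrBl mul1r divff//.
exact: cauchyT_neq0.
Qed.

Let dotC (u v : Cx R) : R :=
  complex.Re u * complex.Re v + complex.Im u * complex.Im v.

Let cmodB2 u v : cmod (u - v) ^+ 2 = cmod u ^+ 2 - 2 * dotC u v + cmod v ^+ 2.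
Proof. by rewrite !sqr_cmod /dotC; case: u v => [a b] [c d] /=; ring. Qed.

(* With [g = kern z], [A] its mean and [r = |z|], [kern_identity] makes the variance
   [E|g - A|^2] an affine function of [A] equal to
   [|A|^2 (r^2 - |eta|^2) / (1 - r^2)], while [g - A = g A (z zeta - eta)] bounds
   it below by a multiple of the variance of [z zeta]. *)
Lemma etaT_schwarz z : cmod z < 1 ->
  cmod (etaT P z) ^+ 2 <= cmod z ^+ 2 *
    (1 - (1 - cmod z ^+ 2) * (1 - cmod z) ^+ 2 * circle_var P / 64).
Proof.
move=> z1; set r := cmod z; set e := etaT P z; set A := cauchyT z.
have r0 : 0 <= r := cmod_ge0 z.
have r1 : r < 1 := z1.
have A0 : A != 0 := cauchyT_neq0 z1.
have eE : e = 1 - A^-1 := etaTE z1.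
have c0 : 0 < 1 - r ^+ 2 by rewrite subr_gt0 expr_lt1.
set c := (1 - r ^+ 2)^-1.
have cc : c * (1 - r ^+ 2) = 1 by rewrite mulVf// lt0r_neq0.
have bk := circle_boundedC_kern z1.
have bz := @circle_boundedC_cplx R.
(* For the real inner product, [<z zeta, e> = <zeta, q>], which is linear in the coordinates of
   [zeta]. *)
pose q := (z : Cx R)^*%C * e.
have pw p : unit_circle p -> cmod (kern z p - A) ^+ 2 >= cmod (z * cplx p - e) ^+ 2 / 16.
  move=> cp; have d0 := dist1_circle_neq0 z1 cp.
  have -> : kern z p - A = kern z p * A * (z * cplx p - e).
    by rewrite /kern eE; field; rewrite d0 A0.
  rewrite !cmodM !exprMn mulrC ler_wpM2r ?sqr_ge0//.
  have -> : (16^-1 : R) = (1 / 2) ^+ 2 * (1 / 2) ^+ 2 by field.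
  have h0 : 0 <= (1 / 2 : R) by lra.
  by rewrite ler_pM ?sqr_ge0// ler_pXn2r ?nnegrE ?cmod_ge0// ?cmod_kern_ge// cmod_cauchyT_ge.
have main : (r ^+ 2 - 2 * dotC q (moment1 P) + cmod e ^+ 2) / 16 <=
    c * (2 * complex.Re A - 1) - cmod A ^+ 2.
  have := @circle_affine_le R P PT _ _ _ _
     (- 2 * complex.Re q / 16) (- 2 * complex.Im q / 16) ((r ^+ 2 + cmod e ^+ 2) / 16)
     (2 * c - 2 * complex.Re A) (- 2 * complex.Im A) (cmod A ^+ 2 - c)
     bz.1 bz.2 bk.1 bk.2.
  rewrite -[Rintegral P setT (fun p => complex.Re (cplx p))]/(complex.Re (moment1 P)).
  rewrite -[Rintegral P setT (fun p => complex.Im (cplx p))]/(complex.Im (moment1 P)).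
  rewrite -[Rintegral P setT (fun p => complex.Re (kern z p))]/(complex.Re A).
  rewrite -[Rintegral P setT (fun p => complex.Im (kern z p))]/(complex.Im A).
  have A2 : cmod A ^+ 2 = complex.Re A ^+ 2 + complex.Im A ^+ 2 := sqr_cmod A.
  move=> H; lapply H => {H}; first by rewrite /dotC A2; lra.
  move=> p cp; have := pw _ cp; rewrite !cmodB2 => hpw.
  have kk := kern_identity z1 cp.
  have kk2 : cmod (kern z p) ^+ 2 = c * (2 * complex.Re (kern z p) - 1).
    by rewrite -kk mulrA cc mul1r.
  rewrite kk2 cmodM cmod_cplx// mulr1 in hpw.
  have dE : dotC (z * cplx p) e =
      complex.Re q * complex.Re (cplx p) + complex.Im q * complex.Im (cplx p).
    by rewrite /dotC /q; case: (z) (e) (p) => [? ?] [? ?] [? ?] /=; ring.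
  rewrite dE in hpw; move: hpw; rewrite /dotC -/r => hpw.
  by lra.
have mm : dotC q (moment1 P) = dotC (z * moment1 P) e.
  by rewrite /dotC /q; case: (z) (e) (moment1 P) => [? ?] [? ?] [? ?] /=; ring.
(* The mean minimises the mean square distance: [E|z zeta - e|^2] exceeds the variance of [z zeta]
   by [|z m - e|^2], with [m] the first moment. *)
have lo : r ^+ 2 * circle_var P <= r ^+ 2 - 2 * dotC q (moment1 P) + cmod e ^+ 2.
  have := sqr_ge0 (cmod (z * moment1 P - e)); rewrite cmodB2 -mm cmodM exprMn.
  by rewrite /circle_var -/r; lra.
(* This is the equation of [kern_identity] with [e] in place of [z zeta], since
   [A = 1 / (1 - e)]. *)
have A2 : 2 * complex.Re A - 1 = (1 - cmod e ^+ 2) * cmod A ^+ 2.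
  have AE : A = (1 - e)^-1 by rewrite eE opprB addrC subrK invrK.
  have e0 : 1 - e != 0 by rewrite eE opprB addrC subrK invr_eq0.
  move: e0; rewrite AE; case: (e) => [a b] /cmod_gt0 n0.
  have d0 : (1 - a) ^+ 2 + b ^+ 2 != 0.
    by have := exprn_gt0 2 n0; rewrite sqr_cmod /= => /lt0r_neq0; rewrite sub0r sqrrN.
  by rewrite cmodV exprVn !sqr_cmod /= sub0r sqrrN; field.
have hi : r ^+ 2 * circle_var P / 16 <= cmod A ^+ 2 * (c * (r ^+ 2 - cmod e ^+ 2)).
  apply: le_trans (_ : (r ^+ 2 - 2 * dotC q (moment1 P) + cmod e ^+ 2) / 16 <= _).
    by rewrite ler_pM2r.
  apply: le_trans main _; rewrite A2.
  have -> : c * ((1 - cmod e ^+ 2) * cmod A ^+ 2) - cmod A ^+ 2 =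
     cmod A ^+ 2 * (c * (1 - cmod e ^+ 2) - c * (1 - r ^+ 2)) by rewrite cc; ring.
  by rewrite -mulrBr (_ : 1 - cmod e ^+ 2 - (1 - r ^+ 2) = r ^+ 2 - cmod e ^+ 2)//; ring.
(* This 4, times the 16 from [|kern|, |A| >= 1/2], is the 64 of the statement. *)
have hA : cmod A ^+ 2 * (1 - r) ^+ 2 <= 4.
  have -> : (4 : R) = 2 ^+ 2 by ring.
  rewrite -exprMn ler_pXn2r ?nnegrE ?mulr_ge0 ?cmod_ge0 ?subr_ge0 ?(ltW r1)//.
  by rewrite -ler_pdivlMr ?subr_gt0// cmod_cauchyT_le.
have Ap : 0 < cmod A ^+ 2 by rewrite exprn_gt0// cmod_gt0.
set S := r ^+ 2 - cmod e ^+ 2 in hi *.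
have hi' : (1 - r ^+ 2) * (r ^+ 2 * circle_var P / 16) <= cmod A ^+ 2 * S.
  by rewrite -ler_pdivlMl// -/c mulrCA.
have S0 : 0 <= S.
  have : 0 <= cmod A ^+ 2 * S.
    apply: le_trans hi'; rewrite mulr_ge0 ?(ltW c0)//.
    by rewrite mulr_ge0// mulr_ge0 ?sqr_ge0// circle_var_ge0.
  by rewrite pmulr_rge0.
have : (1 - r) ^+ 2 * ((1 - r ^+ 2) * (r ^+ 2 * circle_var P / 16)) <= 4 * S.
  apply: le_trans (_ : (1 - r) ^+ 2 * (cmod A ^+ 2 * S) <= _).
    by rewrite ler_wpM2l ?sqr_ge0.
  by rewrite mulrA [_ * cmod A ^+ 2]mulrC ler_wpM2r.
by rewrite /S; lra.
Qed.

Lemma etaT_le z : cmod z < 1 -> cmod (etaT P z) <= cmod z.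
Proof.
move=> z1; rewrite -(ler_pXn2r (n := 2)) ?nnegrE ?cmod_ge0//.
apply: le_trans (etaT_schwarz z1) _; rewrite -[leRHS]mulr1.
rewrite ler_wpM2l ?sqr_ge0// gerBl divr_ge0// mulr_ge0 ?circle_var_ge0//.
by rewrite mulr_ge0 ?sqr_ge0// subr_ge0 expr_le1 ?cmod_ge0// ltW.
Qed.

(** The second-order remainder of the kernel is exactly [(w - z)^2 zeta^2 kern(z)^2 kern(w)];
    integrating it gives the bound. *)
Lemma cauchyT_diff z w : cmod z < 1 -> cmod w < 1 ->
  cmod (cauchyT w - cauchyT z
     - (w - z) * cintegral P (fun p => cplx p * kern z p * kern z p)) <=
  2 * (cmod (w - z) ^+ 2 * ((1 - cmod z)^-1 ^+ 2 * (1 - cmod w)^-1)).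
Proof.
move=> z1 w1.
have bz := circle_boundedC_kern z1; have bw := circle_boundedC_kern w1.
have bd : circle_boundedC (fun p => cplx p * kern z p * kern z p).
  by do 2 apply: circle_boundedCM => //; exact: circle_boundedC_cplx.
have bm k F : circle_boundedC F -> circle_boundedC (fun p : R * R => k * F p).
  by apply: circle_boundedCM; exact: circle_boundedC_cst.
have bz' := bm (-1) _ bz; have bd' := bm (- (w - z)) _ bd.
have bzd := circle_boundedCD bz' bd'.
have -> : cauchyT w - cauchyT z
    - (w - z) * cintegral P (fun p => cplx p * kern z p * kern z p) =
  cintegral P (fun p => kern w p +
    (-1 * kern z p + - (w - z) * (cplx p * kern z p * kern z p))).
  rewrite (cintegralD PT bw bzd) (cintegralD PT bz' bd') (cintegralZ PT _ bz).
  by rewrite (cintegralZ PT _ bd) mulN1r mulNr addrA.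
apply: (cintegral_norm_le PT); first exact: circle_boundedCD.
move=> p cp; have z0 := dist1_circle_neq0 z1 cp; have w0 := dist1_circle_neq0 w1 cp.
have -> : kern w p + (-1 * kern z p + - (w - z) * (cplx p * kern z p * kern z p)) =
   (w - z) ^+ 2 * (cplx p ^+ 2 * (kern z p ^+ 2 * kern w p)).
  by rewrite /kern; field; rewrite z0 w0.
rewrite !expr2 !cmodM cmod_cplx// !mul1r.
have k0 : 0 <= (1 - cmod z)^-1 by rewrite invr_ge0 subr_ge0 ltW.
by rewrite !ler_pM ?mulr_ge0 ?cmod_ge0// cmod_kern_le.
Qed.

(** The derivative in [z] at a fixed time, with the quadratic remainder that the chain rule
    [slopeC_comp] takes as input. *)
Lemma etaT_differentiable z : cmod z < 1 -> exists (d : Cx R) (K D : R), 0 < D /\ 0 <= K /\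
  forall w, cmod (w - z) < D ->
    cmod (etaT P w - etaT P z - d * (w - z)) <= K * cmod (w - z) ^+ 2.
Proof.
move=> z1.
set d := cintegral P (fun p => cplx p * kern z p * kern z p).
(* For [|w - z| < l] one has [1 - |w| > l], so the remainder bound becomes uniform in [w]. *)
set l := (1 - cmod z) / 2.
have l0 : 0 < l by rewrite divr_gt0// subr_gt0.
pose K1 := 2 * ((1 - cmod z)^-1 ^+ 2 * l^-1).
have K10 : 0 <= K1.
  by rewrite /K1 mulr_ge0// mulr_ge0 ?sqr_ge0// invr_ge0 ltW.
exists (d * (cauchyT z)^-1 ^+ 2), (4 * K1 + cmod d * 8 * (cmod d + K1 * l)), l.
split=> //; split.
  have d0 := cmod_ge0 d; have K1l : 0 <= K1 * l by rewrite mulr_ge0// ltW.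
  by rewrite addr_ge0// mulr_ge0// ?addr_ge0// mulr_ge0.
move=> w wz.
have w1 : cmod w < 1 - l.
  by apply: le_lt_trans (cmod_le_dist w z) _; move: wz; rewrite /l; lra.
have w1' : cmod w < 1 by lra.
have := cauchyT_diff z1 w1'; rewrite -/d => h.
have {}h : cmod (cauchyT w - cauchyT z - (w - z) * d) <= K1 * cmod (w - z) ^+ 2.
  apply: le_trans h _; rewrite /K1 mulrCA mulrC ler_wpM2r ?sqr_ge0//.
  rewrite ler_pM2l// ler_wpM2l ?sqr_ge0// lef_pV2 ?posrE ?subr_gt0//.
  by move: w1; lra.
have z0 := cauchyT_neq0 z1; have w0 := cauchyT_neq0 w1'.
have h2 : cmod (cauchyT z - cauchyT w) <= (cmod d + K1 * l) * cmod (w - z).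
  rewrite cmodB; apply: le_trans (cmod_le_dist _ ((w - z) * d)) _.
  rewrite [leRHS]mulrDl cmodM [cmod d * _]mulrC lerD2l; apply: le_trans h _.
  by rewrite -[leRHS]mulrA ler_wpM2l// expr2 ler_wpM2r ?cmod_ge0// ltW.
rewrite !etaTE//.
(* The first term is the remainder of [A], the second the effect of replacing [1 / A(w)] by
   [1 / A(z)]. Both are quadratic in [w - z]; as [|1 / A| <= 2], their coefficients carry [2^2] and
   [2^3]. *)
have -> : 1 - (cauchyT w)^-1 - (1 - (cauchyT z)^-1) - d * (cauchyT z)^-1 ^+ 2 * (w - z) =
  (cauchyT w - cauchyT z - (w - z) * d) * ((cauchyT z)^-1 * (cauchyT w)^-1) +
  (w - z) * d * ((cauchyT z)^-1 * ((cauchyT z)^-1 * (cauchyT w)^-1))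
    * (cauchyT z - cauchyT w).
  by field; rewrite z0 w0.
have cz := cmod_cauchyTV_le z1; have cw := cmod_cauchyTV_le w1'.
have czw : cmod (cauchyT z)^-1 * cmod (cauchyT w)^-1 <= 4.
  have -> : (4 : R) = 2 * 2 by ring.
  by rewrite ler_pM ?cmod_ge0.
have czzw : cmod (cauchyT z)^-1 * (cmod (cauchyT z)^-1 * cmod (cauchyT w)^-1) <= 8.
  have -> : (8 : R) = 2 * 4 by ring.
  by rewrite ler_pM ?mulr_ge0 ?cmod_ge0.
apply: le_trans (cmodD _ _) _; rewrite !cmodM [leRHS]mulrDl lerD//.
  rewrite -mulrA mulrC ler_pM ?mulr_ge0 ?cmod_ge0// 1?mulrC//.
rewrite expr2 [leRHS](_ : _ =
  cmod (w - z) * cmod d * 8 * ((cmod d + K1 * l) * cmod (w - z))); last by ring.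
by rewrite !ler_pM ?mulr_ge0 ?cmod_ge0.
Qed.

End OnCircle.

Lemma etaT_meq (P Q : probability (R * R)%type R) : meq P Q -> etaT P = etaT Q.
Proof.
move=> PQ; have E f : Rintegral P setT f = Rintegral Q setT f.
  by congr fine; apply: eq_measure_integral => A mA _; exact: PQ.
by apply/funext => z; rewrite /etaT /psiT /cintegral !E.
Qed.

Lemma etaT_dirac (P : probability (R * R)%type R) p z : on_circle P -> meq P (\d_p) ->
  cmod z < 1 -> unit_circle p /\ etaT P z = z * cplx p.
Proof.
move=> PT Pp z1.
have cp : unit_circle p.
  have := Pp _ (@measurable_unit_circle R); rewrite PT diracE.
  case: (boolP (p \in _)); first by rewrite inE.
  by move=> _ /(congr1 fine) /= /eqP; rewrite oner_eq0.
split=> //.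
have E f : circle_bounded f -> Rintegral P setT f = f p.
  move=> [mf _]; rewrite /Rintegral.
  rewrite (@eq_measure_integral _ _ _ _ (\d_p)); last by move=> A mA _; exact: Pp.
  rewrite integral_dirac ?diracT ?mul1e//; exact/measurable_EFinP.
have bk := circle_boundedC_kern z1.
have d0 := dist1_circle_neq0 z1 cp.
have -> : etaT P z = 1 - (kern z p)^-1.
  rewrite etaTE// /cauchyT /cintegral (E _ bk.1) (E _ bk.2).
  by case: (kern z p).
by rewrite /kern invrK opprB addrC subrK.
Qed.

End EtaEstimates.

(** * One-sided derivatives and mean value estimates *)

Section Derivatives.
Context {R : realType}.
Implicit Types (f g X Y : R -> R) (x : R -> Cx R) (t l : R).

(** The derivative relative to [[0, +oo)] in little-o form: nothing is divided by [h], so [h = 0] is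
    allowed and the complex version has the same shape. *)
Definition has_slope f t l := forall e : R, 0 < e -> exists2 d : R, 0 < d &
  forall h, `|h| < d -> 0 <= t + h -> `|f (t + h) - f t - h * l| <= e * `|h|.

Definition has_slopeC x t (l : Cx R) := forall e : R, 0 < e -> exists2 d : R, 0 < d &
  forall h : R, `|h| < d -> 0 <= t + h ->
    cmod (x (t + h) - x t - h%:C%C * l) <= e * `|h|.

Lemma has_slope_deriv f t l : has_deriv_nonneg f t l -> has_slope f t l.
Proof.
move=> /cvgrPdist_le H e e0; have /= := H e e0.
rewrite near_withinE => /nbhs_ballP[d /= d0 hd]; exists d => // h hh th.
have [->|h0] := eqVneq h 0; first by rewrite addr0 subrr mul0r subrr normr0 mulr0.
have /= := hd h; rewrite /ball /= sub0r normrN => /(_ hh (conj h0 th)) Hh.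
rewrite -ler_pdivrMr ?normr_gt0// -normrV ?unitfE// -normrM.
rewrite distrC in Hh; move: Hh; congr (`|_| <= _).
by field.
Qed.

Lemma has_slopeC_deriv x t (l : Cx R) : has_derivC_nonneg x t l -> has_slopeC x t l.
Proof.
move=> [/has_slope_deriv Hr /has_slope_deriv Hi] e e0.
have e2 : 0 < e / 2 by rewrite divr_gt0.
have [d1 d10 h1] := Hr _ e2; have [d2 d20 h2] := Hi _ e2.
exists (Num.min d1 d2); first by rewrite lt_min d10.
move=> h; rewrite lt_min => /andP[hd1 hd2] th.
apply: le_trans (cmod_le_ReIm _) _.
have -> : e * `|h| = e / 2 * `|h| + e / 2 * `|h| by field.
apply: lerD.
  have := h1 _ hd1 th; congr (`|_| <= _).
  by case: (x (t + h)) (x t) l {Hr Hi h1 h2} => [a b] [c k] [u v] /=; ring.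
have := h2 _ hd2 th; congr (`|_| <= _).
by case: (x (t + h)) (x t) l {Hr Hi h1 h2} => [a b] [c k] [u v] /=; ring.
Qed.

Lemma has_slope_Re x t (l : Cx R) : has_slopeC x t l ->
  has_slope (fun s => complex.Re (x s)) t (complex.Re l).
Proof.
move=> H e e0; have [d d0 hd] := H e e0; exists d => // h hh th.
apply: le_trans (hd h hh th); apply: le_trans (normr_Re_le _).
rewrite le_eqVlt; apply/orP; left; apply/eqP; congr `|_|.
by case: (x (t + h)) (x t) l {H hd} => [a b] [c k] [u v] /=; ring.
Qed.

Lemma has_slope_Im x t (l : Cx R) : has_slopeC x t l ->
  has_slope (fun s => complex.Im (x s)) t (complex.Im l).
Proof.
move=> H e e0; have [d d0 hd] := H e e0; exists d => // h hh th.
apply: le_trans (hd h hh th); apply: le_trans (normr_Im_le _).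
rewrite le_eqVlt; apply/orP; left; apply/eqP; congr `|_|.
by case: (x (t + h)) (x t) l {H hd} => [a b] [c k] [u v] /=; ring.
Qed.

(** At [t = 0] the slope is only one-sided. The mean value theorem asks for derivatives inside the
    interval and mere continuity at its ends, so this suffices. *)
Lemma has_slope_is_derive f t l : 0 < t -> has_slope f t l -> is_derive t 1 f l.
Proof.
move=> t0 H.
suff cv : h^-1 *: (f (h *: 1 + t) - f t) @[h --> 0^'] --> l.
  by apply: DeriveDef; [apply/cvg_ex; exists l|exact: cvg_lim].
apply/cvgrPdist_le => e e0; have [d d0 hd] := H e e0.
have m0 : 0 < Num.min d t by rewrite lt_min d0.
rewrite near_withinE; apply/nbhs_ballP; exists (Num.min d t) => //= h.
rewrite /ball /= sub0r normrN lt_min => /andP[hh ht] h0.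
have th : 0 <= t + h by move: ht; rewrite ltr_norml => /andP[+ _]; lra.
have := hd h hh th; rewrite -ler_pdivrMr ?normr_gt0// -normrV ?unitfE// -normrM distrC.
congr (`|_| <= _); rewrite /GRing.scale /= mulr1 [h + t]addrC.
by field.
Qed.

Lemma has_slope_dist f t l : has_slope f t l -> forall e : R, 0 < e -> exists2 d : R, 0 < d &
  forall s, `|s - t| < d -> 0 <= s -> `|f s - f t| <= e.
Proof.
move=> H e e0; have [d d0 hd] := H 1 ltr01.
have k0 : 0 < 1 + `|l| by rewrite ltr_pwDl.
exists (Num.min d (e / (1 + `|l|))); first by rewrite lt_min d0 divr_gt0.
move=> s; rewrite lt_min => /andP[sd se] s0.
have := hd (s - t) sd; rewrite addrC subrK => /(_ s0) H1.
rewrite ltr_pdivlMr// in se.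
have -> : f s - f t = f s - f t - (s - t) * l + (s - t) * l by ring.
apply: le_trans (ler_normD _ _) _; rewrite normrM.
by apply: le_trans (lerD H1 (lexx _)) _; move: se; rewrite mul1r mulrDr mulr1; lra.
Qed.

Lemma within_continuous_dist f (T : R) :
  (forall t, 0 <= t <= T -> forall e : R, 0 < e -> exists2 d : R, 0 < d &
     forall s, `|s - t| < d -> 0 <= s <= T -> `|f s - f t| <= e) ->
  {within `[0, T], continuous f}.
Proof.
move=> H; apply/subspace_continuousP => t /=; rewrite in_itv /= => tT.
apply/cvgrPdist_le => e e0; have [d d0 hd] := H t tT e e0.
rewrite near_withinE; apply/nbhs_ballP; exists d => //= s.
by rewrite /ball /= distrC in_itv /= => st sT; rewrite distrC hd.
Qed.

Lemma has_slope_within_continuous f (l : R -> R) (T : R) :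
  (forall t, 0 <= t <= T -> has_slope f t (l t)) -> {within `[0, T], continuous f}.
Proof.
move=> H; apply: within_continuous_dist => t tT e e0.
have [d d0 hd] := has_slope_dist (H t tT) e0.
by exists d => // s sd /andP[s0 _]; exact: hd.
Qed.

Lemma itv0_pos (T c : R) : c \in `]0, T[%R -> 0 < c /\ 0 <= c <= T.
Proof. by rewrite in_itv /= => /andP[c0 cT]; rewrite c0 !ltW. Qed.

Lemma has_slope0_cst f (T : R) : 0 < T ->
  (forall t, 0 <= t <= T -> has_slope f t 0) -> f T = f 0.
Proof.
move=> T0 H.
have [] := @MVT R f (fun=> 0) 0 T T0.
- by move=> t /itv0_pos[t0 tT]; apply: has_slope_is_derive => //; exact: H.
- exact: (@has_slope_within_continuous _ (fun=> 0)).
- by move=> c _ /eqP; rewrite mul0r subr_eq0 => /eqP.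
Qed.

(** Gronwall: the last hypothesis makes the derivative of [(X^2 + Y^2) exp(2 M t)] nonnegative. *)
Lemma norm_growth_lower X Y (p q : R -> R) (T M : R) : 0 < T ->
  (forall t, 0 <= t <= T -> has_slope X t (p t)) ->
  (forall t, 0 <= t <= T -> has_slope Y t (q t)) ->
  (forall t, 0 <= t <= T ->
     - M * (X t ^+ 2 + Y t ^+ 2) <= X t * p t + Y t * q t) ->
  X 0 ^+ 2 + Y 0 ^+ 2 <= (X T ^+ 2 + Y T ^+ 2) * expR (2 * M * T).
Proof.
move=> T0 HX HY Hb.
pose phi t := (X t * X t + Y t * Y t) * expR (2 * M * t).
have cX := has_slope_within_continuous HX; have cY := has_slope_within_continuous HY.
have [] := @MVT R phi
   (fun t => expR (2 * M * t) * (2 * (X t * p t + Y t * q t + M * (X t ^+ 2 + Y t ^+ 2)))) 0 T T0.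
- move=> t /itv0_pos[t0 tT].
  have dX := has_slope_is_derive t0 (HX t tT).
  have dY := has_slope_is_derive t0 (HY t tT).
  have dE : is_derive t 1 (fun t => expR (2 * M * t)) (expR (2 * M * t) * (2 * M)).
    by apply: is_derive1_comp; rewrite -[X in is_derive _ _ _ X]mulr1; exact: is_deriveZ.
  have dphi : is_derive t 1 phi _ :=
    is_deriveM (is_deriveD (is_deriveM dX dX) (is_deriveM dY dY)) dE.
  apply: is_derive_eq dphi _; rewrite /GRing.scale /=.
  rewrite -[(_ + _) t]/(X t * X t + Y t * Y t).
  by ring.
- move=> t.
  apply: (@continuousM R (subspace `[0, T]) (fun t => X t * X t + Y t * Y t)
    (fun t => expR (2 * M * t))).
    apply: (@continuousD R R (subspace `[0, T]) (fun t => X t * X t) (fun t => Y t * Y t)).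
      by apply: (@continuousM R (subspace `[0, T]) X X); exact: cX.
    by apply: (@continuousM R (subspace `[0, T]) Y Y); exact: cY.
  apply: continuous_subspaceT => s; apply: continuous_comp; last exact: continuous_expR.
  by apply: continuousM; [exact: cvg_cst|exact: cvg_id].
- move=> c /itv0_pos[c0 cT]; rewrite subr0 => phiE.
  have : 0 <= phi T - phi 0.
    rewrite phiE mulr_ge0 ?(ltW T0)// mulr_ge0 ?expR_ge0// mulr_ge0//.
    by have := Hb c cT; rewrite mulNr; lra.
  by rewrite /phi mulr0 expR0 mulr1 -!expr2 subr_ge0.
Qed.

(** Variation of constants for [w = X + iY] and [s = a + ib]: [phi] is the real part of
    [exp(-s t) w(t)], and its derivative is the real part of [exp(-s t) (w' - s w)]. Only the real
    part is treated, so that the real mean value theorem applies. *)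
Lemma rotated_mvt X Y (p q : R -> R) (a b m : R) :
  (forall t, 0 <= t <= 1 -> has_slope X t (p t)) ->
  (forall t, 0 <= t <= 1 -> has_slope Y t (q t)) ->
  (forall t, 0 <= t <= 1 -> `|p t - a * X t + b * Y t| <= m) ->
  (forall t, 0 <= t <= 1 -> `|q t - a * Y t - b * X t| <= m) ->
  `|expR (- a) * (X 1 * cos b + Y 1 * sin b) - X 0| <= 2 * expR `|a| * m.
Proof.
move=> HX HY H1 H2.
pose phi t := expR (- a * t) * (X t * cos (b * t) + Y t * sin (b * t)).
have cX := has_slope_within_continuous HX; have cY := has_slope_within_continuous HY.
have lin (k s : R) : continuous_at s (fun t : R => k * t).
  by apply: continuousM; [exact: cvg_cst|exact: cvg_id].
have dlin (k s : R) : is_derive s 1 (fun t : R => k * t) k.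
  by rewrite -[X in is_derive _ _ _ X]mulr1; exact: is_deriveZ.
have [] := @MVT R phi
   (fun t => expR (- a * t) * ((p t - a * X t + b * Y t) * cos (b * t)
      + (q t - a * Y t - b * X t) * sin (b * t))) 0 1 ltr01.
- move=> t /itv0_pos[t0 tT].
  have dX := has_slope_is_derive t0 (HX t tT).
  have dY := has_slope_is_derive t0 (HY t tT).
  have dE : is_derive t 1 (fun t => expR (- a * t)) (expR (- a * t) * (- a)).
    exact: is_derive1_comp.
  have dC : is_derive t 1 (fun t => cos (b * t)) (- sin (b * t) * b).
    exact: is_derive1_comp.
  have dS : is_derive t 1 (fun t => sin (b * t)) (cos (b * t) * b).
    exact: is_derive1_comp.
  have dphi : is_derive t 1 phi _ :=
    is_deriveM dE (is_deriveD (is_deriveM dX dC) (is_deriveM dY dS)).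
  apply: is_derive_eq dphi _; rewrite /GRing.scale /=.
  rewrite -[(_ + _) t]/(X t * cos (b * t) + Y t * sin (b * t)).
  by ring.
- move=> t; pose S := subspace `[(0 : R), 1].
  apply: (@continuousM R S (fun t => expR (- a * t))
    (fun t => X t * cos (b * t) + Y t * sin (b * t))).
    apply: continuous_subspaceT => s; apply: continuous_comp; last exact: continuous_expR.
    exact: lin.
  apply: (@continuousD R R S (fun t => X t * cos (b * t)) (fun t => Y t * sin (b * t))).
    apply: (@continuousM R S X (fun t => cos (b * t))); first exact: cX.
    by apply: continuous_subspaceT => s; apply: continuous_comp; [exact: lin|exact: continuous_cos].
  apply: (@continuousM R S Y (fun t => sin (b * t))); first exact: cY.
  by apply: continuous_subspaceT => s; apply: continuous_comp; [exact: lin|exact: continuous_sin].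
- move=> c /itv0_pos[c0 cT]; rewrite subr0 mulr1.
  rewrite /phi !mulr0 !mulr1 cos0 sin0 expR0 mul1r mulr1 mulr0 addr0 => ->.
  rewrite normrM ger0_norm ?expR_ge0// [2 * _]mulrC -[leRHS]mulrA.
  have m0 : 0 <= m by apply: le_trans (H1 _ cT).
  rewrite ler_pM ?expR_ge0//.
    rewrite ler_expR; apply: le_trans (ler_norm _) _; rewrite normrM normrN.
    by rewrite ler_piMr// ger0_norm ?(ltW c0)//; case/andP: cT.
  apply: le_trans (ler_normD _ _) _; rewrite !normrM mulr_natl mulr2n.
  apply: lerD; rewrite -[leRHS]mulr1 ler_pM//; do ?[exact: H1|exact: H2].
    by rewrite ler_norml cos_geN1 cos_le1.
  by rewrite ler_norml sin_geN1 sin_le1.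
Qed.

Definition has_slope_at (B : Cx R -> Cx R) (z L : Cx R) := forall e : R, 0 < e -> exists2 d : R, 0 < d &
  forall w, cmod (w - z) < d -> cmod (B w - B z - L * (w - z)) <= e * cmod (w - z).

Lemma derivable_slopeC (B : Cx R -> Cx R) z : derivable B z 1 ->
  exists L : Cx R, has_slope_at B z L.
Proof.
move=> /cvg_ex[L /cvgrPdist_le H]; exists L => e e0.
have ec : 0 < (e%:C%C : R[i]) by rewrite -(ltcR 0 e) in e0.
have /= := H _ ec; rewrite near_withinE => /nbhs_ballP[d /= d0 hd].
(* The radius comes as a positive element of [R[i]], and such an element is real. *)
have dE : d = (complex.Re d)%:C%C.
  by case: d d0 {hd} => a b; rewrite ltcE /= => /andP[/eqP -> _].
have d0' : 0 < complex.Re d by move: d0; rewrite ltcE /= => /andP[].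
exists (complex.Re d) => // w wz.
have [->|wz0] := eqVneq w z; first by rewrite !subrr mulr0 subrr cmod0 mulr0.
have h0 : w - z != 0 by rewrite subr_eq0.
have /= := hd (w - z); rewrite /ball /= sub0r normrN.
have wz' : `|w - z| < d by rewrite dE ltcR.
move=> /(_ wz' h0); rewrite [`|_|]normE_cmod lecR => H1.
have -> : B w - B z - L * (w - z) = - ((w - z) * (L - (w - z)^-1 *: (B ((w - z) *: 1 + z) - B z))).
  rewrite /GRing.scale /= mulr1 subrK; by field.
by rewrite cmodN cmodM mulrC ler_wpM2r ?cmod_ge0.
Qed.

End Derivatives.

(** * The complex exponential and its periods *)

Section ComplexExponential.
Context {R : realType}.

Definition cexp (s : Cx R) : Cx R :=
  Complex (expR (complex.Re s) * cos (complex.Im s)) (expR (complex.Re s) * sin (complex.Im s)).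

Lemma cmod_cexp s : cmod (cexp s) = expR (complex.Re s).
Proof.
apply/eqP; rewrite -(eqrXn2 (n := 2)) ?cmod_ge0 ?expR_ge0//.
by rewrite sqr_cmod /= !exprMn -mulrDr cos2Dsin2 mulr1.
Qed.

Lemma cexp0 : cexp 0 = 1.
Proof. by rewrite /cexp /= expR0 cos0 sin0 mulr1 mulr0. Qed.

Lemma cos_eq1 (x : R) : cos x = 1 -> exists n : int, x = 2 * pi * n%:~R.
Proof.
have pi0 := pi_gt0 R; have tp0 : 0 < 2 * pi :> R by rewrite mulr_gt0.
move=> cx; have /andP[] := floor_itv (x / (2 * pi)); set n := Num.floor _.
rewrite ler_pdivlMr// ltr_pdivrMr// intrD mulr1z => nx xn.
exists n; pose y := x - 2 * pi * n%:~R.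
suff yz : y = 0 by apply/eqP; rewrite -subr_eq0 -/y yz.
have cy : cos y = 1.
  have nE (k : nat) : 2 * pi * (Posz k)%:~R = pi *+ 2 *+ k :> R.
    by rewrite -(mulr_natr (pi *+ 2)) -(mulr_natl pi).
  rewrite -cx /y; case: (n) => k.
    by rewrite -[in RHS](subrK (pi *+ 2 *+ k) x) (periodicn (@cosD2pi R)) nE.
  by rewrite NegzE mulrNz mulrN opprK nE (periodicn (@cosD2pi R)).
have y0 : 0 <= y by rewrite subr_ge0 mulrC.
have y2 : y < 2 * pi by rewrite /y; lra.
have i0 : (0 : R) \in `[0, pi]%R by rewrite in_itv /= lexx ltW.
have [ypi|piy] := leP y pi.
  by apply: cos_inj; rewrite ?cy ?cos0// in_itv /= y0.
have : 2 * pi - y = 0.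
  apply: cos_inj => //; first by rewrite in_itv /=; apply/andP; split; lra.
  by rewrite cos0 addrC mulr_natl cosD2pi cosN.
by move: y2; lra.
Qed.

Lemma cexp_inj_mod (s s' : Cx R) : cexp s = cexp s' ->
  exists n : int, s' = s + @two_pi_i R n.
Proof.
move=> ss'; have := congr1 cmod ss'; rewrite !cmod_cexp => /expR_inj.
case: s s' ss' => [a b] [a' b'] [] /= + + aa'; rewrite -aa' => /mulfI cc /mulfI ss.
have {}cc := cc (lt0r_neq0 (expR_gt0 a)); have {}ss := ss (lt0r_neq0 (expR_gt0 a)).
have : cos (b' - b) = 1 by rewrite cosB cc ss -!expr2 cos2Dsin2.
move=> /cos_eq1[n nE]; exists n; apply: etrans (_ : Complex (a + 0) (b + 2 * pi * n%:~R) = _).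
  by rewrite addr0 -nE addrC subrK.
by [].
Qed.

End ComplexExponential.

(** * Chain rule, and functions with vanishing real part *)

Section SlopeC.
Context {R : realType}.
Implicit Types (x : R -> Cx R) (B : Cx R -> Cx R) (z w l L : Cx R) (t : R).

Lemma has_slope_at_dist B z L : has_slope_at B z L -> forall e : R, 0 < e ->
  exists2 d : R, 0 < d & forall w, cmod (w - z) < d -> cmod (B w - B z) <= e.
Proof.
move=> H e e0; have [d d0 hd] := H 1 ltr01.
have k0 : 0 < 1 + cmod L by rewrite ltr_pwDl ?cmod_ge0.
exists (Num.min d (e / (1 + cmod L))); first by rewrite lt_min d0 divr_gt0.
move=> w; rewrite lt_min => /andP[wd we].
have H1 := hd w wd; rewrite ltr_pdivlMr// in we.
apply: le_trans (cmod_le_dist _ (L * (w - z))) _; rewrite cmodM.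
by move: we; rewrite mulrDr mulr1; lra.
Qed.

Lemma has_slopeC_dist x t l : has_slopeC x t l -> forall e : R, 0 < e ->
  exists2 d : R, 0 < d & forall s, `|s - t| < d -> 0 <= s -> cmod (x s - x t) <= e.
Proof.
move=> H e e0; have e2 : 0 < e / 2 by rewrite divr_gt0.
have [d1 d10 h1] := has_slope_dist (has_slope_Re H) e2.
have [d2 d20 h2] := has_slope_dist (has_slope_Im H) e2.
exists (Num.min d1 d2); first by rewrite lt_min d10.
move=> s; rewrite lt_min => /andP[s1 s2] s0; apply: le_trans (cmod_le_ReIm _) _.
have -> : e = e / 2 + e / 2 by field.
apply: lerD.
  by have := h1 s s1 s0; congr (`|_| <= _); case: (x s) (x t) => [? ?] [].
by have := h2 s s2 s0; congr (`|_| <= _); case: (x s) (x t) => [? ?] [].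
Qed.

Lemma has_slopeN (f : R -> R) t (l : R) : has_slope f t l -> has_slope (fun s => - f s) t (- l).
Proof.
move=> H e e0; have [d d0 hd] := H e e0; exists d => // h hh th.
by have := hd h hh th; rewrite -normrN; congr (`|_| <= _); ring.
Qed.

(** Chain rule combined with uniqueness of the derivative from the right: two first-order expansions
    of [y (t + h) = F (x h)] are compared at a single small [h > 0]. *)
Lemma slopeC_comp x y t l l' F d (K D : R) : 0 <= t -> has_slopeC x 0 l -> has_slopeC y t l' ->
  0 < D -> 0 <= K ->
  (forall w, cmod (w - x 0) < D ->
     cmod (F w - F (x 0) - d * (w - x 0)) <= K * cmod (w - x 0) ^+ 2) ->
  (forall h : R, 0 <= h -> y (t + h) = F (x h)) -> l' = d * l.
Proof.
move=> t0 Hx Hy D0 K0 HF yF; apply: eqC_small => E E0.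
have kd : 0 < 2 + cmod d by rewrite ltr_pwDl ?cmod_ge0.
(* The errors add up to [e + e + |d| e] times [h]: the expansion of [y], the remainder of [F], and
   [d] times the expansion of [x]. *)
pose e := Num.min 1 (E / (2 + cmod d)).
have e0 : 0 < e by rewrite lt_min ltr01 divr_gt0.
have e1 : e <= 1 by rewrite ge_min lexx.
have eE : e * (2 + cmod d) <= E by rewrite -ler_pdivlMr// ge_min lexx orbT.
have [d1 d10 h1] := Hx e e0; have [d2 d20 h2] := Hy e e0.
pose k := cmod l + 1.
have k0 : 0 < k by rewrite ltr_wpDl ?cmod_ge0.
have Kk0 : 0 <= K * k ^+ 2 by rewrite mulr_ge0 ?sqr_ge0.
have q0 : 0 < K * k ^+ 2 + 1 by rewrite ltr_wpDl.
(* Since [|x h - x 0| <= k h], the bound [D / k] keeps [x h] where [F] is controlled, and the last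
   one gives [K (k h)^2 <= e h]. *)
pose m := Num.min (Num.min d1 d2) (Num.min (D / k) (e / (K * k ^+ 2 + 1))).
have m0 : 0 < m by rewrite !lt_min d10 d20 !divr_gt0.
pose h := m / 2.
have h0 : 0 < h by rewrite divr_gt0.
have hm : h < m by rewrite ltr_pdivrMr// mulr_natr mulr2n ltrDl.
have : h < m by []; rewrite !lt_min => /andP[/andP[hd1 hd2]] /andP[].
rewrite !ltr_pdivlMr// => hD he.
have hn : `|h| = h by rewrite gtr0_norm.
have {}h1 : cmod (x h - x 0 - h%:C%C * l) <= e * h.
  by have := h1 h; rewrite hn add0r => /(_ hd1 (ltW h0)).
have {}h2 : cmod (F (x h) - F (x 0) - h%:C%C * l') <= e * h.
  have := h2 h; rewrite hn => /(_ hd2); rewrite yF ?(ltW h0)//.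
  by have := yF 0 (lexx 0); rewrite addr0 => ->; apply; rewrite addr_ge0// ltW.
have ch : cmod (h%:C%C : Cx R) = h by rewrite cmod_real.
have wz : cmod (x h - x 0) <= k * h.
  apply: le_trans (cmod_le_dist _ (h%:C%C * l)) _; rewrite cmodM ch /k.
  have : e * h <= h by rewrite ler_piMl// ltW.
  by move: h1; lra.
have h3 := HF (x h); have {}h3 := h3 (le_lt_trans wz _).
have {}h3 : cmod (F (x h) - F (x 0) - d * (x h - x 0)) <= e * h.
  apply: le_trans (h3 _) _; first by rewrite mulrC.
  apply: le_trans (_ : K * (k * h) ^+ 2 <= _).
    by rewrite ler_wpM2l// ler_pXn2r ?nnegrE ?cmod_ge0// mulr_ge0// ltW.
  rewrite exprMn expr2 mulrA mulrA ler_pM2r//.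
  by move: he; rewrite mulrDr mulr1 mulrC; move: h0; lra.
rewrite -(ler_pM2l h0) -{1}ch -cmodM.
have -> : h%:C%C * (l' - d * l) = - (F (x h) - F (x 0) - h%:C%C * l') +
   (F (x h) - F (x 0) - d * (x h - x 0)) + d * (x h - x 0 - h%:C%C * l) by ring.
apply: le_trans (cmodD _ _) _; apply: le_trans (lerD (cmodD _ _) (lexx _)) _.
rewrite cmodN cmodM.
have h4 : cmod d * cmod (x h - x 0 - h%:C%C * l) <= cmod d * (e * h).
  by rewrite ler_wpM2l ?cmod_ge0.
have : h * (e * (2 + cmod d)) <= h * E by rewrite ler_pM2l.
by move: h2 h3 h4; lra.
Qed.

(** Cauchy-Riemann in directional form: [Re (L u) = 0] for every unit [u], and [u = 1], [u = i]
    annihilate both parts of [L]. The mean value theorem along a radius then gives constancy. *)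
Lemma Re_zero_constant B : (forall z, cmod z < 1 -> exists L, has_slope_at B z L) ->
  (forall z, cmod z < 1 -> complex.Re (B z) = 0) ->
  forall z, cmod z < 1 -> B z = B 0.
Proof.
move=> HB HR.
have H0 z : cmod z < 1 -> has_slope_at B z 0.
  move=> z1; have [L HL] := HB z z1; suff -> : 0 = L by [].
  have key (u : Cx R) : cmod u = 1 -> complex.Re (L * u) = 0.
    move=> u1; apply/eqP; rewrite -normr_le0; apply/ler_addgt0Pl => e e0; rewrite addr0.
    have [d d0 hd] := HL e e0.
    pose h := Num.min d (1 - cmod z) / 2.
    have m0 : 0 < Num.min d (1 - cmod z) by rewrite lt_min d0 subr_gt0.
    have h0 : 0 < h by rewrite divr_gt0.
    have : h < Num.min d (1 - cmod z) by rewrite ltr_pdivrMr// mulr_natr mulr2n ltrDl.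
    rewrite lt_min => /andP[hd1 hz].
    pose w := z + h%:C%C * u.
    have wz : w - z = h%:C%C * u by rewrite /w addrC addKr.
    have cw : cmod (w - z) = h by rewrite wz cmodM u1 mulr1 cmod_real gtr0_norm.
    have w1 : cmod w < 1 by apply: le_lt_trans (cmod_le_dist w z) _; rewrite cw; lra.
    have := hd w; rewrite cw => /(_ hd1) /(le_trans (normr_Re_le _)).
    rewrite wz mulrCA.
    have -> : complex.Re (B w - B z - h%:C%C * (L * u)) = - (h * complex.Re (L * u)).
      have := HR z z1; have := HR w w1.
      by case: (B w) (B z) (L * u) => [a b] [c k] [r s] /= -> ->; ring.
    by rewrite normrN normrM gtr0_norm// mulrC ler_pM2r.
  have k1 := key 1 (@cmod1 R).
  have ki : cmod (Complex 0 1 : Cx R) = 1 by rewrite /cmod /= expr0n expr1n add0r sqrtr1.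
  have {}ki := key _ ki.
  move: k1 ki; case: (L) => [a b] /=; rewrite !mulr1 !mulr0 subr0 sub0r => -> /eqP.
  by rewrite oppr_eq0 => /eqP ->.
move=> z z1.
suff : complex.Im (B (1%:C%C * z)) = complex.Im (B (0%:C%C * z)).
  rewrite !(rmorph1, rmorph0) mul1r mul0r; have := HR z z1.
  have := HR 0; rewrite cmod0 ltr01 => /(_ isT).
  by case: (B z) (B 0) => [a b] [c d] /= -> -> ->.
apply: (@has_slope0_cst R (fun t => complex.Im (B (t%:C%C * z))) 1 ltr01) => t /andP[t0 t1] e e0.
have tz : cmod (t%:C%C * z) < 1.
  rewrite cmodM cmod_real ger0_norm//; apply: le_lt_trans z1.
  by rewrite ler_piMl ?cmod_ge0.
have [d d0 hd] := H0 _ tz e e0.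
exists d => // h hh th; rewrite mulr0 subr0.
have hz : (t + h)%:C%C * z - t%:C%C * z = h%:C%C * z by rewrite rmorphD /= mulrDl addrC addKr.
have ch : cmod ((t + h)%:C%C * z - t%:C%C * z) <= `|h|.
  by rewrite hz cmodM cmod_real ler_piMr// ltW.
have := hd ((t + h)%:C%C * z) (le_lt_trans ch hh); rewrite mul0r subr0 => Hd.
apply: le_trans (_ : cmod (B ((t + h)%:C%C * z) - B (t%:C%C * z)) <= _).
  apply: le_trans (normr_Im_le _).
  by case: (B _) (B _) => [a b] [c k] /=.
by apply: le_trans Hd _; rewrite ler_pM2l.
Qed.

End SlopeC.

(** * The flow of a single semigroup *)

Section Flow.
Context {R : realType}.
Variables (nu : R -> probability (R * R)%type R) (B : Cx R -> Cx R).
Implicit Types (z w : Cx R) (t : R).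

Let eta t z := etaT (nu t) z.

Hypothesis nuT : forall t, 0 <= t -> on_circle (nu t).
Hypothesis etaD : forall s t, 0 <= s -> 0 <= t -> forall z, cmod z < 1 ->
  eta (s + t) z = eta s (eta t z).
Hypothesis eta0 : forall z, cmod z < 1 -> eta 0 z = z.
Hypothesis Bslope : forall z, cmod z < 1 -> exists L, has_slope_at B z L.
Hypothesis etaB : forall t z, 0 <= t -> cmod z < 1 ->
  has_slopeC (fun s => eta s z) t (eta t z * B (eta t z)).

Let eta_le t z : 0 <= t -> cmod z < 1 -> cmod (eta t z) <= cmod z.
Proof. by move=> t0; apply: etaT_le; exact: nuT. Qed.

Let eta_disc t z : 0 <= t -> cmod z < 1 -> cmod (eta t z) < 1.
Proof. by move=> t0 z1; apply: le_lt_trans (eta_le t0 z1) z1. Qed.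

(** [|eta_s|^2] has derivative [2 Re B(eta_s) |eta_s|^2], and [Re B] attains a minimum along the
    orbit over [[0, T]], so the modulus decays at most exponentially. *)
Lemma flow_neq0 t z : 0 < t -> cmod z < 1 -> z != 0 -> etaT (nu t) z != 0.
Proof.
move=> T0 z1 z0; rewrite -/(eta t z); set T := t in T0 *.
pose b s := complex.Re (B (eta s z)).
have cb : {within `[0, T], continuous b}.
  apply: within_continuous_dist => s /andP[s0 _] e e0.
  have [L HL] := Bslope (eta_disc s0 z1).
  have [d d0 hd] := has_slope_at_dist HL e0.
  have d2 : 0 < d / 2 by rewrite divr_gt0.
  have [d' d'0 hd'] := has_slopeC_dist (etaB s0 z1) d2.
  exists d' => // u us /andP[u0 _].
  have Hd := hd (eta u z) (le_lt_trans (hd' u us u0) _).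
  apply: le_trans (Hd _); last by rewrite ltr_pdivrMr// mulr_natr mulr2n ltrDl.
  apply: le_trans (normr_Re_le _); rewrite /b.
  by case: (B _) (B _) => [? ?] [].
have [c _ hc] := EVT_min (ltW T0) cb.
have := @norm_growth_lower R (fun s => complex.Re (eta s z)) (fun s => complex.Im (eta s z))
  (fun s => complex.Re (eta s z * B (eta s z))) (fun s => complex.Im (eta s z * B (eta s z)))
  T (- b c) T0.
move=> H; lapply H => [{H}H|s /andP[s0 _]]; last exact/has_slope_Re/etaB.
lapply H => [{H}H|s /andP[s0 _]]; last exact/has_slope_Im/etaB.
lapply H => [{H}H|s sT]; last first.
  have -> : complex.Re (eta s z) * complex.Re (eta s z * B (eta s z)) +
      complex.Im (eta s z) * complex.Im (eta s z * B (eta s z)) =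
      b s * (complex.Re (eta s z) ^+ 2 + complex.Im (eta s z) ^+ 2).
    by rewrite /b; case: (eta s z) (B _) => [? ?] [? ?] /=; ring.
  by rewrite opprK ler_wpM2r ?addr_ge0 ?sqr_ge0// hc// in_itv.
apply/eqP => eT; move: H; rewrite -!sqr_cmod eta0// eT cmod0 expr0n mul0r.
by rewrite leNgt exprn_gt0// cmod_gt0.
Qed.

(* [B 0] is the logarithm of the derivative of [eta_1] at the fixed point 0. *)
Lemma flow_multiplier e : 0 < e -> exists2 d : R, 0 < d &
  forall z, cmod z < d -> cmod (etaT (nu 1) z - cexp (B 0) * z) <= e * cmod z.
Proof.
move=> e0; set s := B 0; set a := complex.Re s; set b := complex.Im s.
have K0 : 0 < expR a * (4 * expR `|a|) by rewrite !mulr_gt0 ?expR_gt0.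
pose e' := e / (expR a * (4 * expR `|a|)).
have e'0 : 0 < e' by rewrite divr_gt0.
have c0 : cmod (0 : Cx R) < 1 by rewrite cmod0.
have [L HL] := Bslope c0; have [d d0 hd] := has_slope_at_dist HL e'0.
exists (Num.min d 1) => [|z]; first by rewrite lt_min d0 ltr01.
rewrite lt_min => /andP[zd z1].
pose m := cmod z * e'.
(* This is the defect of the orbit from the linear equation [w' = s w]. The Schwarz lemma keeps the
   whole orbit in [|w| <= |z|], so the defect is small relative to [|z|]. *)
have bound t : 0 <= t <= 1 -> cmod (eta t z * (B (eta t z) - s)) <= m.
  move=> /andP[t0 _]; rewrite cmodM ler_pM ?cmod_ge0 ?eta_le//.
  by apply: hd; rewrite subr0; apply: le_lt_trans (eta_le t0 z1) _.
pose X t := complex.Re (eta t z); pose Y t := complex.Im (eta t z).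
pose p t := complex.Re (eta t z * B (eta t z)); pose q t := complex.Im (eta t z * B (eta t z)).
have HX t : 0 <= t <= 1 -> has_slope X t (p t).
  by move=> /andP[t0 _]; exact/has_slope_Re/etaB.
have HY t : 0 <= t <= 1 -> has_slope Y t (q t).
  by move=> /andP[t0 _]; exact/has_slope_Im/etaB.
have H1 t : 0 <= t <= 1 -> `|p t - a * X t + b * Y t| <= m.
  move=> /bound; apply: le_trans; apply: le_trans (normr_Re_le _).
  rewrite le_eqVlt; apply/orP; left; apply/eqP; congr `|_|; rewrite /p /X /Y /a /b.
  by case: (eta t z) (B _) (s) => [? ?] [? ?] [? ?] /=; ring.
have H2 t : 0 <= t <= 1 -> `|q t - a * Y t - b * X t| <= m.
  move=> /bound; apply: le_trans; apply: le_trans (normr_Im_le _).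
  rewrite le_eqVlt; apply/orP; left; apply/eqP; congr `|_|; rewrite /q /X /Y /a /b.
  by case: (eta t z) (B _) (s) => [? ?] [? ?] [? ?] /=; ring.
have R1 := rotated_mvt HX HY H1 H2.
(* The imaginary part is the real part for [-i w = Y - iX], which satisfies the same approximate
   equation. *)
have R2 : `|expR (- a) * (Y 1 * cos b + (- X 1) * sin b) - Y 0| <= 2 * expR `|a| * m.
  apply: (@rotated_mvt R Y (fun t => - X t) q (fun t => - p t)) => // t tT.
  - exact/has_slopeN/HX.
  - by rewrite mulrN; exact: H2.
  - by have := H1 t tT; rewrite -normrN; congr (`|_| <= _); ring.
pose y : Cx R := Complex (expR (- a) * (X 1 * cos b + Y 1 * sin b))
                  (expR (- a) * (Y 1 * cos b + (- X 1) * sin b)).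
have ea : expR a * expR (- a) = 1 by rewrite expRN mulfV// gt_eqF ?expR_gt0.
have cs := cos2Dsin2 b.
have yE : etaT (nu 1) z = cexp s * y.
  apply: etrans (_ : Complex (X 1) (Y 1) = _).
    by rewrite /X /Y /eta; case: (etaT _ _).
  apply: etrans (_ : Complex
     (expR a * cos b * (expR (- a) * (X 1 * cos b + Y 1 * sin b)) -
      expR a * sin b * (expR (- a) * (Y 1 * cos b + (- X 1) * sin b)))
     (expR a * cos b * (expR (- a) * (Y 1 * cos b + (- X 1) * sin b)) +
      expR a * sin b * (expR (- a) * (X 1 * cos b + Y 1 * sin b))) = _); last by [].
  congr Complex.
    transitivity ((expR a * expR (- a)) * (X 1 * (cos b ^+ 2 + sin b ^+ 2))); last by ring.
    by rewrite ea cs mul1r mulr1.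
  transitivity ((expR a * expR (- a)) * (Y 1 * (cos b ^+ 2 + sin b ^+ 2))); last by ring.
  by rewrite ea cs mul1r mulr1.
rewrite yE -mulrBr cmodM cmod_cexp -/a.
have yz : cmod (y - z) <= 4 * expR `|a| * m.
  apply: le_trans (cmod_le_ReIm _) _.
  have -> : 4 * expR `|a| * m = 2 * expR `|a| * m + 2 * expR `|a| * m by ring.
  move: R1 R2; rewrite {2}/X {3}/Y eta0// => R1 R2.
  by apply: lerD; [move: R1|move: R2]; rewrite /y; case: (z) => ? ? /=.
apply: le_trans (_ : expR a * (4 * expR `|a| * m) <= _).
  by rewrite ler_pM2l ?expR_gt0.
have eE : expR a * (4 * expR `|a|) * e' = e by rewrite mulrC divfK// gt_eqF.
rewrite -[X in _ <= X * _]eE /m le_eqVlt; apply/orP; left; apply/eqP.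
by move: (e') => f; ring.
Qed.

Lemma flow_generator t z d (K D : R) : 0 <= t -> cmod z < 1 -> 0 < D -> 0 <= K ->
  (forall w, cmod (w - z) < D ->
    cmod (etaT (nu t) w - etaT (nu t) z - d * (w - z)) <= K * cmod (w - z) ^+ 2) ->
  etaT (nu t) z * B (etaT (nu t) z) = d * (z * B z).
Proof.
move=> t0 z1 D0 K0 H.
have Hx := etaB (lexx 0) z1; rewrite eta0// in Hx.
apply: (slopeC_comp t0 Hx (etaB t0 z1) D0 K0 (F := eta t)) => [w|h h0].
  by rewrite eta0//; exact: H.
by rewrite /= etaD.
Qed.

(** The contraction factor of [etaT_schwarz] increases with the modulus and the orbit never leaves
    [|w| <= |z|], so the ratio [q] computed at [|z|] serves at every step. *)
Lemma flow_nat_cvg0 z e : ~ is_dirac (nu 1) -> cmod z < 1 -> 0 < e ->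
  exists n : nat, cmod (etaT (nu n%:R) z) <= e.
Proof.
move=> nd z1 e0.
have nu1 : on_circle (nu 1) := nuT ler01.
have V0 := circle_var_gt0 nu1 nd.
set r := cmod z in z1 *; have r0 : 0 <= r := cmod_ge0 z.
pose k := (1 - r ^+ 2) * (1 - r) ^+ 2 * circle_var (nu 1) / 64.
have r2 : r ^+ 2 < 1 by rewrite expr_lt1.
have k0 : 0 < k.
  by rewrite divr_gt0// !mulr_gt0// ?exprn_gt0// subr_gt0.
have V1 : circle_var (nu 1) <= 1 by rewrite gerBl sqr_ge0.
have k1 : k <= 1.
  rewrite /k ler_pdivrMr// mul1r; apply: (@le_trans _ _ 1); last by lra.
  have r20 := sqr_ge0 r.
  have s0 : 0 <= (1 - r) ^+ 2 by rewrite sqr_ge0.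
  have s1 : (1 - r) ^+ 2 <= 1 by rewrite expr_le1//; move: r0 z1; lra.
  have u0 : 0 <= 1 - r ^+ 2 by lra.
  apply: mulr_ile1 => //; [exact: mulr_ge0|exact: ltW|].
  by apply: mulr_ile1 => //; lra.
pose q := 1 - k.
have q0 : 0 <= q by rewrite subr_ge0.
have step w : cmod w <= r -> cmod (eta 1 w) ^+ 2 <= q * cmod w ^+ 2.
  move=> wr; have w1 : cmod w < 1 := le_lt_trans wr z1.
  apply: le_trans (etaT_schwarz nu1 w1) _; rewrite [leRHS]mulrC ler_wpM2l ?sqr_ge0//.
  have w0 := cmod_ge0 w.
  rewrite /q lerD2l lerN2 /k ler_pM2r// ler_pM2r//.
  rewrite ler_pM ?sqr_ge0 ?subr_ge0 ?(ltW r2)//.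
    by rewrite lerD2l lerN2 ler_pXn2r ?nnegrE.
  by rewrite ler_pXn2r ?nnegrE ?subr_ge0 ?(ltW z1) ?(ltW w1)// lerD2l lerN2.
have iter_ n : cmod (eta n%:R z) ^+ 2 <= q ^+ n * r ^+ 2.
  elim: n => [|n IH]; first by rewrite eta0// expr0 mul1r.
  rewrite -addn1 natrD addrC etaD// addn1.
  apply: le_trans (step _ (eta_le _ z1)) _ => //.
  by rewrite [q ^+ _]exprS -mulrA ler_wpM2l.
have qn : `|q| < 1 by rewrite ger0_norm// /q gtrBl.
have /cvgrPdist_lt/(_ (e ^+ 2)) := cvg_expr qn.
rewrite exprn_gt0// => /(_ isT)[n _ /(_ n (leqnn n))] /=.
rewrite sub0r normrN ger0_norm ?exprn_ge0// => qe.
exists n; rewrite -(ler_pXn2r (n := 2)) ?nnegrE ?cmod_ge0 ?(ltW e0)//.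
apply: le_trans (iter_ n) _; rewrite -[leRHS]mulr1.
by rewrite ler_pM ?exprn_ge0 ?(ltW qe) ?(ltW r2).
Qed.

(** If [B 0 = 0], then [eta_1] is tangent to the identity at 0, while the Schwarz defect shrinks
    moduli by a fixed factor near 0. *)
Lemma flow_B0_neq0 : ~ is_dirac (nu 1) -> B 0 != 0.
Proof.
move=> nd; apply/eqP => B0.
have nu1 : on_circle (nu 1) := nuT ler01.
have V0 := circle_var_gt0 nu1 nd.
have V1 : circle_var (nu 1) <= 1 by rewrite gerBl sqr_ge0.
(* The Schwarz defect at [|z| = 1/2], a lower bound for smaller moduli. The tolerance [k / 4] below
   contradicts it because [(1 - k / 4)^2 > 1 - k]. *)
pose k := 3 / 4 * (1 / 4) * circle_var (nu 1) / 64.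
have k0 : 0 < k by rewrite /k !mulr_gt0.
have k1 : k < 1 by rewrite /k; lra.
have k4 : 0 < k / 4 by rewrite divr_gt0.
have [d d0 hd] := flow_multiplier k4.
pose x := Num.min d 1 / 2; pose z : Cx R := (x%:C)%C.
have m0 : 0 < Num.min d 1 by rewrite lt_min d0 ltr01.
have x0 : 0 < x by rewrite divr_gt0.
have xm : x < Num.min d 1 by rewrite ltr_pdivrMr// mulr_natr mulr2n ltrDl.
have xh : x <= 1 / 2 by rewrite ler_pM2r// ge_min lexx orbT.
have cz : cmod z = x by rewrite cmod_real gtr0_norm.
have := hd z; rewrite cz; move: xm; rewrite lt_min => /andP[xd x1] /(_ xd).
rewrite B0 cexp0 mul1r => H.
have z1 : cmod z < 1 by rewrite cz.
have := etaT_schwarz nu1 z1; rewrite cz => S.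
have lo : x * (1 - k / 4) <= cmod (etaT (nu 1) z).
  have := cmod_le_dist z (etaT (nu 1) z); rewrite cz cmodB => H1.
  by move: H; lra.
have kx : k <= (1 - x ^+ 2) * (1 - x) ^+ 2 * circle_var (nu 1) / 64.
  rewrite /k ler_pM2r// ler_pM2r// ler_pM//; first by nra.
  by nra.
have : (x * (1 - k / 4)) ^+ 2 <= x ^+ 2 * (1 - k).
  apply: le_trans (_ : cmod (etaT (nu 1) z) ^+ 2 <= _).
    rewrite ler_pXn2r ?nnegrE ?cmod_ge0// mulr_ge0 ?(ltW x0)//.
    by move: k1; lra.
  apply: le_trans S _; rewrite ler_wpM2l ?sqr_ge0//.
  by move: kx; lra.
rewrite exprMn ler_pM2l ?exprn_gt0//.
have : 0 <= (k / 4) ^+ 2 by rewrite sqr_ge0.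
by move: k0; rewrite sqrrB expr1n mul1r; lra.
Qed.

Lemma flow_dirac_constant : (forall z, cmod z < 1 -> complex.Re (B z) <= 0) ->
  is_dirac (nu 1) -> forall z, cmod z < 1 -> B z = B 0.
Proof.
move=> RB [p nup].
have nu1 : on_circle (nu 1) := nuT ler01.
have iso z h : cmod z < 1 -> 0 <= h <= 1 -> cmod (eta h z) = cmod z.
  move=> z1 /andP[h0 h1]; apply/eqP; rewrite eq_le eta_le//=.
  have [cp eE] := etaT_dirac nu1 nup z1.
  (* [eta_1] is a rotation and factors as [eta_(1 - h) o eta_h]; neither factor increases the
     modulus, so [eta_h] cannot decrease it. *)
  have -> : cmod z = cmod (eta 1 z) by rewrite /eta eE cmodM cmod_cplx// mulr1.
  have h1' : 0 <= 1 - h by rewrite subr_ge0.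
  by rewrite -{1}(subrK h 1) etaD// eta_le// eta_disc.
(* To first order [|z| = |eta_h(z)|] is [|z| |1 + h B(z)|], and
   [|1 + h b|^2 = 1 + 2 h Re b + h^2 |b|^2]. *)
have R1 z : cmod z < 1 -> z != 0 -> 0 <= complex.Re (B z).
  move=> z1 z0; have c0 := cmod_gt0 z0.
  apply/ler_addgt0Pl => e e0.
  have e2 : 0 < cmod z * (e / 2) by rewrite mulr_gt0// divr_gt0.
  have Hx := etaB (lexx 0) z1; rewrite eta0// in Hx.
  have [d d0 hd] := Hx _ e2.
  set b := B z in hd *.
  have q0 : 0 < cmod b ^+ 2 + 1 by rewrite ltr_wpDl ?sqr_ge0.
  (* The bound 1 is the range of the isometry, [e / (|b|^2 + 1)] absorbs [h |b|^2], and [1 / e]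
     keeps [1 - e h / 2] nonnegative, so that squaring is monotone. *)
  pose m := Num.min (Num.min d 1) (Num.min (e / (cmod b ^+ 2 + 1)) (1 / e)).
  have m0 : 0 < m by rewrite !lt_min d0 ltr01 !divr_gt0.
  pose h := m / 2.
  have h0 : 0 < h by rewrite divr_gt0.
  have : h < m by rewrite ltr_pdivrMr// mulr_natr mulr2n ltrDl.
  rewrite !lt_min => /andP[/andP[hd1 h1]] /andP[]; rewrite !ltr_pdivlMr// => hq he.
  have := hd h; rewrite add0r gtr0_norm// => /(_ hd1 (ltW h0)); rewrite eta0// => H.
  have lo : 1 - e / 2 * h <= cmod (1 + h%:C%C * b).
    rewrite -(ler_pM2l c0) -cmodM.
    have := cmod_le_dist (eta h z) (z * (1 + h%:C%C * b)).
    rewrite iso// ?(ltW h0) ?(ltW h1)//.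
    have -> : eta h z - z * (1 + h%:C%C * b) = eta h z - z - h%:C%C * (z * b) by ring.
    by move: H; lra.
  have lo2 : (1 - e / 2 * h) ^+ 2 <= cmod (1 + h%:C%C * b) ^+ 2.
    by rewrite ler_pXn2r ?nnegrE ?cmod_ge0//; move: he; lra.
  have sq : cmod (1 + h%:C%C * b) ^+ 2 = 1 + h * (2 * complex.Re b + h * cmod b ^+ 2).
    by rewrite !sqr_cmod; case: (b) => ? ? /=; ring.
  have : h * (- e) <= h * (2 * complex.Re b + h * cmod b ^+ 2).
    have : 0 <= (e / 2 * h) ^+ 2 by rewrite sqr_ge0.
    by move: lo2; rewrite sq sqrrB expr1n mul1r; lra.
  rewrite ler_pM2l//; move: hq; rewrite mulrDr mulr1.
  by move: h0; lra.
apply: Re_zero_constant => // z z1; apply/eqP; rewrite eq_le RB//=.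
have [->|] := eqVneq z 0; last exact: R1.
(* At 0 the modulus of the orbit carries no information; the sign is obtained there by continuity
   from a nearby nonzero point. *)
apply/ler_addgt0Pl => e e0.
have c0 : cmod (0 : Cx R) < 1 by rewrite cmod0.
have [L HL] := Bslope c0; have [d d0 hd] := has_slope_at_dist HL e0.
pose x := Num.min d 1 / 2; pose w : Cx R := (x%:C)%C.
have m0 : 0 < Num.min d 1 by rewrite lt_min d0 ltr01.
have x0 : 0 < x by rewrite divr_gt0.
have : x < Num.min d 1 by rewrite ltr_pdivrMr// mulr_natr mulr2n ltrDl.
rewrite lt_min => /andP[xd x1].
have cw : cmod w = x by rewrite cmod_real gtr0_norm.
have w0 : w != 0 by apply/eqP => w0; move: x0; rewrite -cw w0 cmod0 ltxx.
have w1 : cmod w < 1 by rewrite cw.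
have := hd w; rewrite subr0 cw => /(_ xd) /(le_trans (normr_Re_le _)).
have := R1 w w1 w0; case: (B w) (B 0) => [a b] [c k] /= a0.
by rewrite ler_norml => /andP[_]; lra.
Qed.

End Flow.

(** * Semigroup hypotheses in terms of the real modulus *)

Lemma semigroup_eta0 (R : realType) (mu : R -> probability (R * R)%type R) :
  monotone_semigroup mu -> meq (mu 0) (\d_((1 : R), (0 : R))) ->
  forall z, cmod z < 1 -> etaT (mu 0) z = z.
Proof.
move=> [muT _] mu0 z z1; have [_ ->] := etaT_dirac (muT 0 (lexx 0)) mu0 z1.
by rewrite -[cplx _]/(1 : Cx R) mulr1.
Qed.

Lemma semigroup_etaD (R : realType) (mu : R -> probability (R * R)%type R) :
  monotone_semigroup mu -> forall s t, 0 <= s -> 0 <= t -> forall z, cmod z < 1 ->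
  etaT (mu (s + t)) z = etaT (mu s) (etaT (mu t) z).
Proof. by move=> [_ [h _]] s t s0 t0 z z1; apply: h => //; rewrite discE. Qed.

Lemma disc_slope_at (R : realType) (F : Cx R -> Cx R) :
  (forall z, disc z -> derivable F z 1) ->
  forall z, cmod z < 1 -> exists L, has_slope_at F z L.
Proof. by move=> h z z1; apply: derivable_slopeC; apply: h; rewrite discE. Qed.

Lemma disc_slopeC (R : realType) (mu : R -> probability (R * R)%type R) (F : Cx R -> Cx R) :
  (forall t z, 0 <= t -> disc z ->
     has_derivC_nonneg (fun s => etaT (mu s) z) t (etaT (mu t) z * F (etaT (mu t) z))) ->
  forall t z, 0 <= t -> cmod z < 1 ->
    has_slopeC (fun s => etaT (mu s) z) t (etaT (mu t) z * F (etaT (mu t) z)).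
Proof. by move=> h t z t0 z1; apply: has_slopeC_deriv; apply: h => //; rewrite discE. Qed.

(** * Two semigroups with the same measure at time 1 *)

Section TwoFlows.
Context {R : realType}.
Variables (nu nut : R -> probability (R * R)%type R) (B Bt : Cx R -> Cx R).
Implicit Types z : Cx R.

Hypothesis nu_sg : monotone_semigroup nu.
Hypothesis nut_sg : monotone_semigroup nut.
Hypothesis nu0 : meq (nu 0) (\d_((1 : R), (0 : R))).
Hypothesis nut0 : meq (nut 0) (\d_((1 : R), (0 : R))).
Hypothesis nu1 : meq (nu 1) (nut 1).
Hypothesis Bder : forall z, disc z -> derivable B z 1.
Hypothesis Btder : forall z, disc z -> derivable Bt z 1.
Hypothesis nuB : forall t z, 0 <= t -> disc z ->
  has_derivC_nonneg (fun s => etaT (nu s) z) t (etaT (nu t) z * B (etaT (nu t) z)).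
Hypothesis nutB : forall t z, 0 <= t -> disc z ->
  has_derivC_nonneg (fun s => etaT (nut s) z) t (etaT (nut t) z * Bt (etaT (nut t) z)).

Let eta_id := semigroup_eta0 nu_sg nu0.
Let etat_id := semigroup_eta0 nut_sg nut0.
Let ode := disc_slopeC nuB.
Let odet := disc_slopeC nutB.
Let nuT := nu_sg.1.
Let nutT := nut_sg.1.

(** Both sides are the derivative at 0 of the common map [eta_1]; the two expansions are compared at
    one small real point. *)
Lemma two_flows_multiplier : cexp (B 0) = cexp (Bt 0).
Proof.
apply: eqC_small => e e0; have e2 : 0 < e / 2 by rewrite divr_gt0.
have [d d0 hd] := flow_multiplier nuT eta_id (disc_slope_at Bder) ode e2.
have [k k0 hk] := flow_multiplier nutT etat_id (disc_slope_at Btder) odet e2.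
pose x := Num.min d k / 2; pose z : Cx R := (x%:C)%C.
have m0 : 0 < Num.min d k by rewrite lt_min d0.
have x0 : 0 < x by rewrite divr_gt0.
have : x < Num.min d k by rewrite ltr_pdivrMr// mulr_natr mulr2n ltrDl.
have cz : cmod z = x by rewrite cmod_real gtr0_norm.
rewrite lt_min -cz => /andP[/hd H1 /hk H2].
rewrite -(ler_pM2r x0) -{1}cz -cmodM.
have -> : (cexp (B 0) - cexp (Bt 0)) * z =
    (etaT (nut 1) z - cexp (Bt 0) * z) - (etaT (nu 1) z - cexp (B 0) * z).
  by rewrite (etaT_meq nu1); ring.
apply: le_trans (cmodD _ _) _; rewrite cmodN.
by move: H1 H2; rewrite cz; lra.
Qed.

Lemma two_flows_nat n z : cmod z < 1 -> etaT (nut n%:R) z = etaT (nu n%:R) z.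
Proof.
move=> z1; elim: n => [|n IH].
  by rewrite eta_id// etat_id.
by rewrite -addn1 natrD addrC (semigroup_etaD nut_sg)// (semigroup_etaD nu_sg)// IH (etaT_meq nu1).
Qed.

(* Differentiating [eta_(n + h) = eta_n o eta_h] at [h = 0] gives
   [eta_n'(z) z B(z) = eta_n(z) B(eta_n(z))] for both semigroups, which share [eta_n]. *)
Lemma two_flows_commute n z : cmod z < 1 -> z != 0 ->
  B (etaT (nu n%:R) z) * Bt z = Bt (etaT (nu n%:R) z) * B z.
Proof.
move=> z1 z0; have n0 : 0 <= n%:R :> R by [].
have [d [K [D [D0 [K0 H]]]]] := etaT_differentiable (nuT n0) z1.
have E1 := flow_generator (semigroup_etaD nu_sg) eta_id ode n0 z1 D0 K0 H.
(* The smaller radius keeps [w] in the disc, where the two maps at time [n] coincide; the derivative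
   [d] is then shared. *)
pose D' := Num.min D (1 - cmod z).
have D'0 : 0 < D' by rewrite lt_min D0 subr_gt0.
have E2 : etaT (nu n%:R) z * Bt (etaT (nu n%:R) z) = d * (z * Bt z).
  rewrite -two_flows_nat//.
  apply: (flow_generator (semigroup_etaD nut_sg) etat_id odet n0 z1 D'0 K0).
  move=> w; rewrite lt_min => /andP[wD w1].
  rewrite !two_flows_nat//; first exact: H.
  by apply: le_lt_trans (cmod_le_dist w z) _; move: w1; lra.
have [n00|n1] := posnP n.
  by rewrite n00 eta_id// mulrC.
have nn : 0 < n%:R :> R by rewrite ltr0n.
have w0 := flow_neq0 nuT eta_id (disc_slope_at Bder) ode nn z1 z0.
apply: (mulfI w0); rewrite !mulrA E1 E2; ring.
Qed.

Lemma two_flows_proportional z : ~ is_dirac (nu 1) -> cmod z < 1 ->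
  B 0 * Bt z = Bt 0 * B z.
Proof.
move=> nd z1; have [->|z0] := eqVneq z 0; first by rewrite mulrC.
apply: eqC_small => e e0.
pose M := cmod (B z) + cmod (Bt z) + 1.
have M0 : 0 < M by rewrite ltr_wpDl ?addr_ge0 ?cmod_ge0.
have eM : 0 < e / M by rewrite divr_gt0.
have c0 : cmod (0 : Cx R) < 1 by rewrite cmod0.
have [L HL] := disc_slope_at Bder c0; have [L' HL'] := disc_slope_at Btder c0.
have [d d0 hd] := has_slope_at_dist HL eM; have [k k0 hk] := has_slope_at_dist HL' eM.
have m0 : 0 < Num.min d k / 2 by rewrite divr_gt0// lt_min d0.
have [n nw] := flow_nat_cvg0 nuT (semigroup_etaD nu_sg) eta_id nd z1 m0.
set w := etaT (nu n%:R) z in nw.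
have : cmod w < Num.min d k.
  by apply: le_lt_trans nw _; rewrite ltr_pdivrMr// mulr_natr mulr2n ltrDl lt_min d0.
rewrite lt_min => /andP[wd wk].
have := hd w; rewrite subr0 => /(_ wd) H1; have := hk w; rewrite subr0 => /(_ wk) H2.
have E := two_flows_commute n z1 z0; rewrite -/w in E.
(* The last bracket vanishes by the commutation identity, and the other two terms are small because
   [w] is close to 0. *)
have -> : B 0 * Bt z - Bt 0 * B z =
    (Bt w - Bt 0) * B z - (B w - B 0) * Bt z + (B w * Bt z - Bt w * B z) by ring.
rewrite E subrr addr0; apply: le_trans (cmodD _ _) _; rewrite cmodN !cmodM.
apply: (@le_trans _ _ (e / M * cmod (B z) + e / M * cmod (Bt z))).
  by rewrite lerD// ler_wpM2r ?cmod_ge0.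
rewrite -mulrDr -{2}(divfK (lt0r_neq0 M0) e) ler_pM2l// /M.
by rewrite lerDl ler01.
Qed.

End TwoFlows.

Theorem theorem5p8 (R : realType)
  (nu nut : R -> probability (R * R)%type R) (B2 B2t : Cx R -> Cx R) :
  monotone_semigroup nu -> monotone_semigroup nut ->
  meq (nu 0) (\d_((1 : R), (0 : R))) -> meq (nut 0) (\d_((1 : R), (0 : R))) ->
  meq (nu 1) (nut 1) ->
  ~ meq (nu 1) (@haarT R) ->
  (forall z, @disc R z -> derivable B2 z 1) ->
  (forall z, @disc R z -> derivable B2t z 1) ->
  (forall z, @disc R z -> complex.Re (B2 z) <= 0) ->
  (forall z, @disc R z -> complex.Re (B2t z) <= 0) ->
  (forall t z, 0 <= t -> @disc R z ->
     has_derivC_nonneg (fun s => etaT (nu s) z) t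
       (etaT (nu t) z * B2 (etaT (nu t) z))) ->
  (forall t z, 0 <= t -> @disc R z ->
     has_derivC_nonneg (fun s => etaT (nut s) z) t
       (etaT (nut t) z * B2t (etaT (nut t) z))) ->
  let s1 := B2 0 in
  (~ is_dirac (nu 1) ->
     exists n : int, forall z, @disc R z ->
       B2t z = (1 + @two_pi_i R n / s1) * B2 z) /\
  (is_dirac (nu 1) ->
     exists n : int, forall z, @disc R z -> B2t z = B2 z + @two_pi_i R n).
Proof.
move=> nu_sg nut_sg nu0 nut0 nu1 _ Bder Btder RB RBt nuB nutB s1.
have [n nE] := cexp_inj_mod
  (two_flows_multiplier nu_sg nut_sg nu0 nut0 nu1 Bder Btder nuB nutB).
have Bs := disc_slope_at Bder; have Bts := disc_slope_at Btder.
have ode := disc_slopeC nuB; have odet := disc_slopeC nutB.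
have eta0 := semigroup_eta0 nu_sg nu0; have etat0 := semigroup_eta0 nut_sg nut0.
split=> [nd|dd]; exists n => z; rewrite discE => z1.
  have s10 : s1 != 0 := flow_B0_neq0 nu_sg.1 eta0 Bs ode nd.
  apply: (mulfI s10).
  rewrite (two_flows_proportional nu_sg nut_sg nu0 nut0 nu1 Bder Btder nuB nutB nd z1) nE.
  by rewrite -/s1; field.
(* Both generators are constant in this case, so their difference is its value at 0, already known
   to be a multiple of [2 pi i]. *)
have ddt : is_dirac (nut 1).
  by case: dd => p np; exists p => A mA; rewrite -nu1// np.
have RB' w : cmod w < 1 -> complex.Re (B2 w) <= 0 by move=> w1; apply: RB; rewrite discE.
have RBt' w : cmod w < 1 -> complex.Re (B2t w) <= 0 by move=> w1; apply: RBt; rewrite discE.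
rewrite (flow_dirac_constant nu_sg.1 (semigroup_etaD nu_sg) eta0 Bs ode RB' dd z1) -nE.
exact: (flow_dirac_constant nut_sg.1 (semigroup_etaD nut_sg) etat0 Bts odet RBt' ddt z1).
Qed.
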